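(* Let $k$ be a field, let $X$ be a finite set, let $(E,R)$ be a finite poset, and let $V$ be a simple left $k\mathrm{Aut}(E,R)$-module. Let $T$ be a finite lattice such that $\mathrm{Irr}(T)=(E,R)$ and such that the restriction homomorphism $\mathrm{Aut}(T)\to\mathrm{Aut}(E,R)$ is an isomorphism. Let $\mathcal{B}_{E,R,X}=\{\varphi\in T^X\mid E\subseteq\varphi(X)\subseteq G\}$, where $G=G(T)$. Then: (a) $S_{E,R^{op},V}(X)\cong k\mathcal{B}_{E,R,X}\otimes_{k\mathrm{Aut}(E,R)}V$ as $k$-vector spaces, an isomorphism from right to left being given by $\varphi\otimes v\mapsto\Psi_X\big(\Theta_{T,X}(\varphi)\otimes v\big)$. (b) Transporting the action of relations via this isomorphism, the action of a relation $U\in\mathcal{C}(X,X)$ on an element $\varphi\otimes v\in k\mathcal{B}_{E,R,X}\otimes_{k\mathrm{Aut}(E,R)}V$ (with $\varphi\in\mathcal{B}_{E,R,X}$, $v\in V$) is given by $$U\cdot(\varphi\otimes v)=\pi_{T,X}(u_T\circ U\varphi)\otimes v.$$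
   Context: **Lattices.** In a finite lattice $T$ (least element $\hat0$, greatest element $\hat1$), an element $e$ is irreducible if $e=\bigvee_{a\in A}a$ with $A\subseteq T$ implies $e\in A$ (so $\hat0$ is not irreducible). $\mathrm{Irr}(T)=(E,R)$ denotes the set $E$ of irreducible elements with the order $R$ induced from $T$; $R^{op}$ is the opposite order; $\mathrm{Aut}(E,R)=\mathrm{Aut}(E,R^{op})$. For $t\in T$: $r(t)$ is the join of all elements strictly smaller than $t$, and $r^\infty(t)$ is the stable value of the iterates $r^n(t)$; $\sigma(t)$ is the meet of all irreducible elements strictly larger than $t$ (empty meet $=\hat1$), and $\sigma^\infty(t)$ is the stable value of the iterates $\sigma^n(t)$. $G=G(T)=E\sqcup\{a\in T\mid a=r^\infty(\sigma^\infty(a))\}$ and $G^c=T-G=\{a\in T\mid a\notin E,\ a<r^\infty(\sigma^\infty(a))\}$. **The elements $u_a$, $u_T$, $\pi_{T,X}$.** For $a\in G^c$, with $b=r^\infty(\sigma^\infty(a))$, there is a unique integer $r\geq0$ such that $a<\sigma(a)<\dots<\sigma^r(a)<b\leq\sigma^{r+1}(a)$; put $(a_0,\dots,a_{r+1})=(a,\sigma(a),\dots,\sigma^r(a),b)$. For distinct elements $c_0,\dots,c_n$ of $T$ ($n\geq1$), $[c_0,\dots,c_n]:T\to T$ is the map sending $c_j$ to $c_{j+1}$ for $0\leq j\leq n-1$ and fixing every other element. Set $u_a=[a_0,a_1]-[a_0,a_1,a_2]+\dots+(-1)^r[a_0,a_1,\dots,a_{r+1}]\in k(T^T)$, the free $k$-module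 on the set of maps $T\to T$. $u_T$ is the composition (extended bilinearly) of all the $u_a$, $a\in G^c$, in some order (identity if $G^c=\emptyset$). For $\varphi\in T^X$, $u_T\circ\varphi\in k(T^X)$ is defined by bilinear extension of composition of maps. $\pi_{T,X}:k(T^X)\to k(T^X)$ is the $k$-linear map with $\pi_{T,X}(\varphi)=\varphi$ if $E\subseteq\varphi(X)$ and $0$ otherwise. For a relation $U\subseteq X\times X$ and $\varphi\in T^X$, $(U\varphi)(y)=\bigvee_{(y,x)\in U}\varphi(x)$ (empty join $=\hat0$). One has $\pi_{T,X}(u_T\circ U\varphi)\in k\mathcal{B}_{E,R,X}$, where $k\mathcal{B}_{E,R,X}\subseteq k(T^X)$ is the subspace with basis $\mathcal{B}_{E,R,X}$. The right action of $\tau\in\mathrm{Aut}(E,R)\cong\mathrm{Aut}(T)$ on $\mathcal{B}_{E,R,X}$ is $\varphi\cdot\tau=\tau^{-1}\circ\varphi$. **Correspondences.** $\mathcal{C}(Y,X)$ is the set of all subsets of $Y\times X$; $SQ=\{(z,x)\mid\exists y,\ (z,y)\in S,\ (y,x)\in Q\}$ for $S\subseteq Z\times Y$, $Q\subseteq Y\times X$; $k\mathcal{C}(Y,X)$ is its $k$-linearization with bilinear composition. $\Delta_E=\{(e,e)\mid e\in E\}$, $\Delta_\alpha=\{(\alpha(e),e)\mid e\in E\}$ for a permutation $\alpha$ of $E$. **Functors.** For a finite poset $(E,R)$, $\mathcal{P}_Ef_R$ is the left $k\mathcal{C}(E,E)$-module with $k$-basis $\{\Delta_\alpha f_R\}$,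 $\alpha$ running over the permutations of $E$ ($f_R:=\Delta_{\mathrm{id}}f_R$), where a relation $Q$ acts by $Q\cdot\Delta_\alpha f_R=\Delta_{\beta\alpha}f_R$ if there is a (necessarily unique) permutation $\beta$ with $\Delta_E\subseteq\Delta_{\beta^{-1}}Q\subseteq\{(\alpha(e),\alpha(f))\mid(e,f)\in R\}$, and by $0$ otherwise; $\tau\in\mathrm{Aut}(E,R)$ acts on the right by $\Delta_\alpha f_R\cdot\tau=\Delta_{\alpha\tau}f_R$. For a left $k\mathcal{C}(E,E)$-module $W$, $L_{E,W}(X)=k\mathcal{C}(X,E)\otimes_{k\mathcal{C}(E,E)}W$ and $J_{E,W}(X)=\{\sum_i\varphi_i\otimes w_i\mid\forall\rho\in k\mathcal{C}(E,X),\ \sum_i(\rho\varphi_i)\cdot w_i=0\}$, with correspondences acting by left composition. $\mathbb{S}_{E,R}=L_{E,\mathcal{P}_Ef_R}/J_{E,\mathcal{P}_Ef_R}$ (with induced right $k\mathrm{Aut}(E,R)$-action) and $S_{E,R,V}=L_{E,W}/J_{E,W}$ with $W=\mathcal{P}_Ef_R\otimes_{k\mathrm{Aut}(E,R)}V$; these are used with $R^{op}$ in place of $R$. $\Theta_{T,X}:k(T^X)\to\mathbb{S}_{E,R^{op}}(X)$ is the $k$-linear map sending $\varphi$ to the class of $\Gamma_\varphi\otimes f_{R^{op}}$, where $\Gamma_\varphi=\{(x,e)\in X\times E\mid e\leq\varphi(x)\}$. $\Psi_X:\mathbb{S}_{E,R^{op}}(X)\otimes_{k\mathrm{Aut}(E,R)}V\to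 S_{E,R^{op},V}(X)$ is the map $[\varphi\otimes m]\otimes v\mapsto[\varphi\otimes(m\otimes v)]$. *)

(* Defs.v *)
From HB Require Import structures.
From mathcomp Require Import all_boot all_order all_algebra perm.
From mathcomp Require Import freeg boolp.

Set Implicit Arguments.
Unset Strict Implicit.
Unset Printing Implicit Defensive.

Import Order.TTheory GRing.Theory.
Local Open Scope ring_scope.
Local Open Scope quotient_scope.

Reserved Notation "m \ox n" (at level 40, left associativity).

Section Quotient.
Variables (V : zmodType) (S : {pred V}) (hS : zmod_closed S).

Definition subgrp (h : zmod_closed S) : {pred V} := S.

HB.instance Definition _ := GRing.isZmodClosed.Build V (subgrp hS) hS.

Definition zquot := Quotient.quot (subgrp hS).

HB.instance Definition _ := GRing.Zmodule.on zquot.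

Definition zproj (v : V) : zquot := \pi_(Quotient.quot (subgrp hS)) v.

(* The map induced by f on the quotient: zliftE applies when f is constant on *)
(* the classes.                                                               *)
Definition zlift (Z : Type) (f : V -> Z) (q : zquot) : Z :=
  f (repr (q : Quotient.quot (subgrp hS))).

Lemma zprojP v w : reflect (zproj v = zproj w) (v - w \in S).
Proof.
have e : (v - w \in S) = (v == w %[mod Quotient.quot (subgrp hS)]).
  by rewrite -(Quotient.idealrBE (subgrp hS)).
by rewrite e; apply: eqP.
Qed.

Lemma zreprK q : zlift zproj q = q.
Proof. exact: reprK. Qed.

Lemma zproj_is_zmod_morphism : zmod_morphism zproj.
Proof.
by move=> v w; rewrite /zproj; rewrite !piE.
Qed.

HB.instance Definition _ :=
  GRing.isZmodMorphism.Build V zquot zproj zproj_is_zmod_morphism.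

Lemma zliftE (Z : Type) (f : V -> Z) :
  (forall v w, v - w \in S -> f v = f w) -> forall v, zlift f (zproj v) = f v.
Proof. by move=> hf v; apply/hf/zprojP; exact: zreprK. Qed.

End Quotient.

Section QuotientModule.
Variables (A : nzRingType) (V : lmodType A).
Variables (S : {pred V}) (hS : GRing.submod_closed S).

Definition lquot := zquot (GRing.submod_closedB hS).

HB.instance Definition _ := GRing.Zmodule.on lquot.

Definition lproj (v : V) : lquot := zproj _ v.

Definition llift (Z : Type) (f : V -> Z) (q : lquot) : Z := zlift f q.

Lemma lprojP v w : reflect (lproj v = lproj w) (v - w \in S).
Proof. exact: zprojP. Qed.

Lemma lreprK q : llift lproj q = q.
Proof. exact: zreprK. Qed.

Lemma lprojD v w : lproj (v + w) = lproj v + lproj w.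
Proof. exact: raddfD. Qed.

Lemma lliftE (Z : Type) (f : V -> Z) :
  (forall v w, v - w \in S -> f v = f w) -> forall v, llift f (lproj v) = f v.
Proof. exact: zliftE. Qed.

Lemma lquotW (P : lquot -> Prop) : (forall v, P (lproj v)) -> forall q, P q.
Proof. by move=> h q; rewrite -(lreprK q); apply: h. Qed.

Lemma submodZ a v : v \in S -> a *: v \in S.
Proof. by case: hS => h0 hl hv; rewrite -[_ *: v]addr0; apply: hl. Qed.

Definition lquot_scale a := llift (fun v => lproj (a *: v)).

Lemma lquot_scaleE a v : lquot_scale a (lproj v) = lproj (a *: v).
Proof.
rewrite /lquot_scale lliftE // => {}v w h; apply/lprojP.
by rewrite -scalerBr submodZ.
Qed.

Lemma lquot_scaleA a b q :
  lquot_scale a (lquot_scale b q) = lquot_scale (a * b) q.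
Proof. by elim/lquotW: q => v; rewrite !lquot_scaleE scalerA. Qed.

Lemma lquot_scale1 : left_id 1 lquot_scale.
Proof. by elim/lquotW => v; rewrite lquot_scaleE scale1r. Qed.

Lemma lquot_scaleDr : right_distributive lquot_scale +%R.
Proof.
move=> a; elim/lquotW => v; elim/lquotW => w.
by rewrite -lprojD !lquot_scaleE scalerDr lprojD.
Qed.

Lemma lquot_scaleDl q : {morph lquot_scale^~ q : a b / a + b}.
Proof.
by elim/lquotW: q => v a b; rewrite !lquot_scaleE scalerDl lprojD.
Qed.

HB.instance Definition _ := GRing.Zmodule_isLmodule.Build A lquot
  lquot_scaleA lquot_scale1 lquot_scaleDr lquot_scaleDl.

Lemma lproj_is_linear : linear lproj.
Proof. by move=> a v w; rewrite lprojD -lquot_scaleE. Qed.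

HB.instance Definition _ :=
  GRing.isLinear.Build A V lquot *:%R lproj lproj_is_linear.

End QuotientModule.

(* Left A-modules are [lmodType A]; an (A, B)-bimodule is a left A-module     *)
(* with a commuting right action of B.                                        *)
Record bimod (A B : nzRingType) := Bimod {
  bimod_sort :> lmodType A;
  ract : bimod_sort -> B -> bimod_sort;
  ractDl : forall m n b, ract (m + n) b = ract m b + ract n b;
  ractDr : forall m b c, ract m (b + c) = ract m b + ract m c;
  ract1 : forall m, ract m 1 = m;
  ractM : forall m b c, ract m (b * c) = ract (ract m b) c;
  ractZ : forall a m b, ract (a *: m) b = a *: ract m b
}.

Section FreeAbelian.
Variables (K : choiceType) (Z : zmodType).

Definition zgen (x : K) : {freeg K} := << x >>.

Definition zfree_lift (f : K -> Z) (t : {freeg K}) : Z :=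
  fglift (f : K -> zmodule Z) t.

Lemma zfree_lift_is_zmod_morphism f : zmod_morphism (zfree_lift f).
Proof. exact: (@lift_is_additive _ _ (zmodule Z)). Qed.

HB.instance Definition _ f := GRing.isZmodMorphism.Build _ _ (zfree_lift f)
  (zfree_lift_is_zmod_morphism f).

Lemma zfree_liftE f x : zfree_lift f (zgen x) = f x.
Proof. by rewrite /zfree_lift /zgen liftU scale1r. Qed.

Lemma zfree_ind (P : {freeg K} -> Prop) :
  (forall x, P (zgen x)) -> P 0 -> (forall s t, P s -> P t -> P (s - t)) ->
  forall t, P t.
Proof.
move=> h1 h0 hB.
have hN t : P t -> P (- t) by rewrite -[- t]sub0r; apply: hB.
have hD s t : P s -> P t -> P (s + t).
  by move=> hs ht; rewrite -[t]opprK; apply: hB => //; apply: hN.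
have hz (c : int) t : P t -> P (t *~ c).
  move=> ht; case: c => n; rewrite ?NegzE ?mulrNz; [|apply: hN];
  by elim: n => [|n ih]; rewrite ?mulr0n // -pmulrn mulrS; apply: hD => //;
     rewrite pmulrn.
move=> t; rewrite -(freeg_sumE t); elim/big_rec: _ => // x s _ hs.
apply: hD => //; have <- : zgen x *~ coeff x t = << coeff x t *g x >>.
  by rewrite /zgen freegU_mulz; congr << _ *g _ >>; rewrite intz.
exact: hz.
Qed.

End FreeAbelian.

Section Tensor.
Variables (A B : nzRingType) (M : bimod A B) (N : lmodType B).

Local Notation F := {freeg (M * N)%type}.

Inductive tensor_relator : F -> Prop :=
| TensorDl m m' n :
    tensor_relator (zgen (m + m', n) - zgen (m, n) - zgen (m', n))
| TensorDr m n n' :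
    tensor_relator (zgen (m, n + n') - zgen (m, n) - zgen (m, n'))
| TensorBal m b n :
    tensor_relator (zgen (ract m b, n) - zgen (m, b *: n)).

Inductive tensor_span : F -> Prop :=
| TensorSpan0 : tensor_span 0
| TensorSpan1 t : tensor_relator t -> tensor_span t
| TensorSpanB s t : tensor_span s -> tensor_span t -> tensor_span (s - t).

Definition tensor_null : {pred F} := fun t => `[< tensor_span t >].

Lemma tensor_null_closed : zmod_closed tensor_null.
Proof.
split; first exact/asboolP/TensorSpan0.
by move=> s t /asboolP hs /asboolP ht; apply/asboolP/TensorSpanB.
Qed.

Definition tensor := zquot tensor_null_closed.

HB.instance Definition _ := GRing.Zmodule.on tensor.

Definition tpure (m : M) (n : N) : tensor := zproj _ (zgen (m, n) : F).
Local Notation "m \ox n" := (tpure m n).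

Lemma tpure_rel t : tensor_relator t -> zproj tensor_null_closed t = 0.
Proof.
move=> ht; rewrite -(raddf0 (zproj tensor_null_closed)); apply/zprojP.
by rewrite subr0; apply/asboolP/TensorSpan1.
Qed.

Lemma tpureDl m m' n : (m + m') \ox n = m \ox n + m' \ox n.
Proof.
apply/eqP; rewrite -subr_eq0 opprD addrA -!raddfB; apply/eqP/tpure_rel.
exact: TensorDl.
Qed.

Lemma tpureDr m n n' : m \ox (n + n') = m \ox n + m \ox n'.
Proof.
apply/eqP; rewrite -subr_eq0 opprD addrA -!raddfB; apply/eqP/tpure_rel.
exact: TensorDr.
Qed.

Lemma tpure_bal m b n : ract m b \ox n = m \ox (b *: n).
Proof.
apply/eqP; rewrite -subr_eq0 -!raddfB; apply/eqP/tpure_rel.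
exact: TensorBal.
Qed.

Lemma tensor_ind (P : tensor -> Prop) :
  (forall m n, P (m \ox n)) -> P 0 -> (forall s t, P s -> P t -> P (s - t)) ->
  forall t, P t.
Proof.
move=> h1 h0 hB t; rewrite -(zreprK t); rewrite /zlift; move: (repr _) => {t}.
apply: zfree_ind => [[m n]||s t hs ht]; first exact: h1.
  by rewrite raddf0.
by rewrite raddfB; apply: hB.
Qed.

Definition balanced (Z : zmodType) (f : M -> N -> Z) :=
  [/\ forall m m' n, f (m + m') n = f m n + f m' n,
      forall m n n', f m (n + n') = f m n + f m n'
    & forall m b n, f (ract m b) n = f m (b *: n)].

(* The additive map on M (x) N induced by a balanced f, see [tliftE].         *)
Definition tlift (Z : zmodType) (f : M -> N -> Z) : tensor -> Z :=
  zlift (zfree_lift (fun p => f p.1 p.2)).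

Section Lift.
Variables (Z : zmodType) (f : M -> N -> Z) (hf : balanced f).

Lemma tlift_const (s t : F) : s - t \in tensor_null ->
  zfree_lift (fun p => f p.1 p.2) s = zfree_lift (fun p => f p.1 p.2) t.
Proof.
move=> /asboolP h; apply/eqP; rewrite -subr_eq0 -raddfB; apply/eqP.
case: hf => h1 h2 h3; elim: h => [|_ [] *|? ? _ e1 _ e2].
- by rewrite raddf0.
- by rewrite !raddfB /= !zfree_liftE /= h1 addrAC addrK subrr.
- by rewrite !raddfB /= !zfree_liftE /= h2 addrAC addrK subrr.
- by rewrite !raddfB /= !zfree_liftE /= h3 subrr.
- by rewrite raddfB e1 e2 subrr.
Qed.

Lemma tliftE m n : tlift f (m \ox n) = f m n.
Proof. by rewrite /tlift zliftE ?zfree_liftE //; apply: tlift_const. Qed.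

Lemma tlift_is_zmod_morphism : zmod_morphism (tlift f).
Proof.
move=> s t; rewrite -(zreprK s) -(zreprK t) /zlift.
move: (repr _) (repr _) => {}s {}t; rewrite -raddfB /tlift.
by rewrite !zliftE ?raddfB //; apply: tlift_const.
Qed.

Lemma tliftB s t : tlift f (s - t) = tlift f s - tlift f t.
Proof. exact: tlift_is_zmod_morphism. Qed.

Lemma tlift0 : tlift f 0 = 0.
Proof. by rewrite -[X in tlift f X](subrr 0) tliftB subrr. Qed.

Lemma tliftD s t : tlift f (s + t) = tlift f s + tlift f t.
Proof.
have -> : s + t = s - (0 - t) by rewrite sub0r opprK.
by rewrite !tliftB tlift0 sub0r opprK.
Qed.

Lemma tlift_sum I (r : seq I) (G : I -> tensor) :
  tlift f (\sum_(i <- r) G i) = \sum_(i <- r) tlift f (G i).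
Proof. exact: (big_morph _ tliftD tlift0). Qed.

End Lift.

Definition tensor_scale a : tensor -> tensor := tlift (fun m n => (a *: m) \ox n).

Lemma tensor_scale_bal a : balanced (fun m n => (a *: m) \ox n).
Proof.
split=> [m m' n|m n n'|m b n]; first by rewrite scalerDr tpureDl.
  by rewrite tpureDr.
by rewrite -ractZ tpure_bal.
Qed.

Lemma tensor_scaleE a m n : tensor_scale a (m \ox n) = (a *: m) \ox n.
Proof. by rewrite /tensor_scale (tliftE (tensor_scale_bal a)). Qed.

HB.instance Definition _ a := GRing.isZmodMorphism.Build tensor tensor
  (tensor_scale a) (tlift_is_zmod_morphism (tensor_scale_bal a)).

Lemma tensor_scaleA a b t :
  tensor_scale a (tensor_scale b t) = tensor_scale (a * b) t.
Proof.
elim/tensor_ind: t => [m n||s t hs ht]; first by rewrite !tensor_scaleE scalerA.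
  by rewrite !raddf0.
by rewrite !raddfB /= hs ht.
Qed.

Lemma tensor_scale1 : left_id 1 tensor_scale.
Proof.
elim/tensor_ind => [m n||s t hs ht]; first by rewrite tensor_scaleE scale1r.
  by rewrite raddf0.
by rewrite !raddfB /= hs ht.
Qed.

Lemma tensor_scaleDr : right_distributive tensor_scale +%R.
Proof. by move=> a s t; rewrite raddfD. Qed.

Lemma tensor_scaleDl t : {morph tensor_scale^~ t : a b / a + b}.
Proof.
move=> a b; elim/tensor_ind: t => [m n||s t hs ht].
- by rewrite !tensor_scaleE scalerDl tpureDl.
- by rewrite !raddf0 addr0.
- by rewrite !raddfB /= hs ht opprD addrACA.
Qed.

HB.instance Definition _ := GRing.Zmodule_isLmodule.Build A tensor
  tensor_scaleA tensor_scale1 tensor_scaleDr tensor_scaleDl.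

Lemma tpureZ a m n : (a *: m) \ox n = a *: (m \ox n).
Proof. exact/esym/tensor_scaleE. Qed.

End Tensor.

Notation "m \ox n" := (tpure m n) : ring_scope.

Section TensorBimodule.
Variables (A B C : nzRingType) (M : bimod A B) (P : bimod B C).

Definition tensor_ract (t : tensor M P) (c : C) : tensor M P :=
  tlift (fun m p => m \ox ract p c) t.

Lemma tensor_ract_bal c : balanced (fun (m : M) (p : P) => m \ox ract p c).
Proof.
split=> [m m' p|m p p'|m b p]; first by rewrite tpureDl.
  by rewrite ractDl tpureDr.
by rewrite tpure_bal ractZ.
Qed.

Lemma tensor_ractE m p c : tensor_ract (m \ox p) c = m \ox ract p c.
Proof. by rewrite /tensor_ract (tliftE (tensor_ract_bal c)). Qed.

Lemma tensor_ractB s t c : tensor_ract (s - t) c = tensor_ract s c - tensor_ract t c.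
Proof. exact: (tliftB (tensor_ract_bal c)). Qed.

Lemma tensor_ract0 c : tensor_ract 0 c = 0.
Proof. exact: (tlift0 (tensor_ract_bal c)). Qed.

Lemma tensor_ractDl s t c : tensor_ract (s + t) c = tensor_ract s c + tensor_ract t c.
Proof. exact: (tliftD (tensor_ract_bal c)). Qed.

Lemma tensor_ractDr t b c : tensor_ract t (b + c) = tensor_ract t b + tensor_ract t c.
Proof.
elim/(@tensor_ind _ _ M P): t => [m p||s t hs ht].
- by rewrite !tensor_ractE ractDr tpureDr.
- by rewrite !tensor_ract0 addr0.
- by rewrite !tensor_ractB hs ht opprD addrACA.
Qed.

Lemma tensor_ract1 t : tensor_ract t 1 = t.
Proof.
elim/(@tensor_ind _ _ M P): t => [m p||s t hs ht].
- by rewrite tensor_ractE ract1.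
- by rewrite tensor_ract0.
- by rewrite tensor_ractB hs ht.
Qed.

Lemma tensor_ractM t b c : tensor_ract t (b * c) = tensor_ract (tensor_ract t b) c.
Proof.
elim/(@tensor_ind _ _ M P): t => [m p||s t hs ht].
- by rewrite !tensor_ractE ractM.
- by rewrite !tensor_ract0.
- by rewrite !tensor_ractB hs ht.
Qed.

Lemma tensor_ractZ a t c : tensor_ract (a *: t) c = a *: tensor_ract t c.
Proof.
elim/(@tensor_ind _ _ M P): t => [m p||s t hs ht].
- by rewrite -tpureZ !tensor_ractE tpureZ.
- by rewrite scaler0 !tensor_ract0 scaler0.
- by rewrite scalerBr !tensor_ractB hs ht scalerBr.
Qed.

Definition tensor_bimod : bimod A C := Bimod tensor_ractDl tensor_ractDr
  tensor_ract1 tensor_ractM tensor_ractZ.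

End TensorBimodule.

Section Free.
Variables (k : fieldType).
Implicit Types I J : finType.

Definition kfree I : Type := {ffun I -> k^o}.

HB.instance Definition _ I := GRing.Lmodule.on (kfree I).

Definition kbase I (i : I) : kfree I := [ffun j => (j == i)%:R].

Definition kext I (V : lmodType k) (f : I -> V) (x : kfree I) : V :=
  \sum_i (x i : k) *: f i.

Lemma kext_is_linear I (V : lmodType k) (f : I -> V) : linear (kext f).
Proof.
move=> a x y; rewrite /kext scaler_sumr -big_split /=; apply: eq_bigr => i _.
by rewrite !ffunE scalerDl scalerA.
Qed.

HB.instance Definition _ I (V : lmodType k) (f : I -> V) :=
  GRing.isLinear.Build k (kfree I) V *:%R (kext f) (kext_is_linear f).

Lemma kextE I (V : lmodType k) (f : I -> V) i : kext f (kbase i) = f i.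
Proof.
rewrite /kext (bigD1 i) //= ffunE eqxx scale1r big1 ?addr0 // => j ne.
by rewrite ffunE (negbTE ne) scale0r.
Qed.

Lemma kfree_sum I (x : kfree I) : x = kext (@kbase I) x.
Proof.
apply/ffunP => i; rewrite /kext sum_ffunE (bigD1 i) //= big1 => [|j ne].
  by rewrite addr0 !ffunE eqxx [_ *: _]mulr1.
by rewrite !ffunE eq_sym (negbTE ne) [_ *: _]mulr0.
Qed.

Lemma kfree_ind I (P : kfree I -> Prop) : P 0 ->
  (forall i, P (kbase i)) -> (forall a x y, P x -> P y -> P (a *: x + y)) ->
  forall x, P x.
Proof.
move=> h0 h1 h x; rewrite (kfree_sum x) /kext.
by elim/big_rec: _ => // i y _ hy; apply: h.
Qed.

Definition kbil I J (V : lmodType k) (f : I -> J -> V) (x : kfree I)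
  (y : kfree J) : V := kext (fun i => kext (f i) y) x.

Lemma kbilE I J (V : lmodType k) (f : I -> J -> V) i j : kbil f (kbase i) (kbase j) = f i j.
Proof. by rewrite /kbil !kextE. Qed.

Lemma kbil_linl I J (V : lmodType k) (f : I -> J -> V) y : linear (kbil f ^~ y).
Proof. by move=> a x x'; exact: linearP. Qed.

Lemma kbil_linr I J (V : lmodType k) (f : I -> J -> V) x : linear (kbil f x).
Proof.
move=> a y y'; rewrite /kbil /kext scaler_sumr -big_split /=.
apply: eq_bigr => i _; rewrite -!/(kext _ _) linearP scalerDr !scalerA.
by rewrite mulrC.
Qed.

Lemma kbilDl I J (V : lmodType k) (f : I -> J -> V) x x' y :
  kbil f (x + x') y = kbil f x y + kbil f x' y.
Proof. by have := kbil_linl f y 1 x x'; rewrite !scale1r. Qed.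

Lemma kbilDr I J (V : lmodType k) (f : I -> J -> V) x y y' :
  kbil f x (y + y') = kbil f x y + kbil f x y'.
Proof. by have := kbil_linr f x 1 y y'; rewrite !scale1r. Qed.

Lemma kbil0l I J (V : lmodType k) (f : I -> J -> V) y : kbil f 0 y = 0.
Proof. by rewrite /kbil linear0. Qed.

Lemma kbil0r I J (V : lmodType k) (f : I -> J -> V) x : kbil f x 0 = 0.
Proof. by rewrite /kbil {1}/kext big1 // => i _; rewrite linear0 scaler0. Qed.

Lemma kbilZl I J (V : lmodType k) (f : I -> J -> V) a x y : kbil f (a *: x) y = a *: kbil f x y.
Proof. by rewrite /kbil linearZ. Qed.

Lemma kbilZr I J (V : lmodType k) (f : I -> J -> V) a x y : kbil f x (a *: y) = a *: kbil f x y.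
Proof. by have := kbil_linr f x a y 0; rewrite kbil0r !addr0. Qed.

Lemma kbil_ext2 I J (V : lmodType k) (g g' : kfree I -> kfree J -> V) :
  (forall y, linear (g^~ y)) -> (forall x, linear (g x)) ->
  (forall y, linear (g'^~ y)) -> (forall x, linear (g' x)) ->
  (forall i j, g (kbase i) (kbase j) = g' (kbase i) (kbase j)) ->
  forall x y, g x y = g' x y.
Proof.
move=> l1 l2 l1' l2' e x y.
have lin0 (W W' : lmodType k) (h : W -> W') : linear h -> h 0 = 0.
  by move=> hl; have := hl 1 0 0; rewrite !scale1r addr0 -{1}[h 0]addr0 => /addrI.
elim/kfree_ind: x => [|i|a x x' hx hx'].
- by rewrite (lin0 _ _ _ (l1 y)) (lin0 _ _ _ (l1' y)).
- elim/kfree_ind: y => [|j|a y y' hy hy'] //.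
    by rewrite (lin0 _ _ _ (l2 _)) (lin0 _ _ _ (l2' _)).
  by rewrite l2 l2' hy hy'.
- by rewrite l1 l1' hx hx'.
Qed.

Lemma kbilA (I J K L IJ JK : finType) (f : I -> J -> kfree IJ) (g : IJ -> K -> kfree L)
    (g' : J -> K -> kfree JK) (f' : I -> JK -> kfree L) :
  (forall i j l, kbil g (f i j) (kbase l) = kbil f' (kbase i) (g' j l)) ->
  forall x y z, kbil g (kbil f x y) z = kbil f' x (kbil g' y z).
Proof.
move=> e x y z; elim/kfree_ind: z => [|l|a z z' hz hz'].
- by rewrite !kbil0r.
- apply: (@kbil_ext2 _ _ _ (fun x y => kbil g (kbil f x y) (kbase l))
    (fun x y => kbil f' x (kbil g' y (kbase l)))) => [v|v|v|v|i j].
  + by move=> a w w'; rewrite !kbil_linl.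
  + by move=> a w w'; rewrite kbil_linr kbil_linl.
  + by move=> a w w'; rewrite kbil_linl.
  + by move=> a w w'; rewrite kbil_linl kbil_linr.
  + by rewrite !kbilE.
- by rewrite !kbil_linr hz hz'.
Qed.

End Free.

Arguments kbase {k I} i.

#[short(type="finMonoidType")]
HB.structure Definition FinMonoid := {M of Monoid M & Finite M}.

Section MonoidAlgebra.
Variables (k : fieldType) (M : finMonoidType).

Definition kmon : Type := kfree k M.

HB.instance Definition _ := GRing.Zmodule.on kmon.

Definition kmon_mul : kmon -> kmon -> kmon :=
  kbil (fun m n : M => kbase (m * n)%g : kfree k M).
Definition kmon_one : kmon := kbase (1%g : M).

Lemma kmon_mulA : associative kmon_mul.
Proof.
by move=> x y z; rewrite /kmon_mul; apply/esym/kbilA => i j l; rewrite !kbilE mulgA.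
Qed.

Lemma kmon_mul1 : left_id kmon_one kmon_mul.
Proof.
by move=> x; rewrite /kmon_mul /kbil kextE [RHS]kfree_sum /kext;
   apply: eq_bigr => i _; rewrite mul1g.
Qed.

Lemma kmon_1mul : right_id kmon_one kmon_mul.
Proof.
by move=> x; rewrite /kmon_mul /kbil [RHS]kfree_sum /kext;
   apply: eq_bigr => i _; rewrite -/(kext _ _) kextE mulg1.
Qed.

Lemma kmon_mulDl : left_distributive kmon_mul +%R.
Proof. by move=> x y z; apply: kbilDl. Qed.

Lemma kmon_mulDr : right_distributive kmon_mul +%R.
Proof. by move=> x y z; apply: kbilDr. Qed.

Lemma kmon_1neq0 : kmon_one != 0.
Proof.
by apply/eqP => /ffunP /(_ 1%g) /eqP; rewrite !ffunE eqxx oner_eq0.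
Qed.

HB.instance Definition _ := GRing.Zmodule_isNzRing.Build kmon
  kmon_mulA kmon_mul1 kmon_1mul kmon_mulDl kmon_mulDr kmon_1neq0.

End MonoidAlgebra.

Section Correspondences.
Implicit Types E X Y Z W : finType.

Definition corr Y X : Type := {set Y * X}.

HB.instance Definition _ Y X := Finite.on (corr Y X).

Definition ccomp Z Y X (S : corr Z Y) (Q : corr Y X) : corr Z X :=
  [set p : Z * X | [exists y, ((p.1, y) \in S) && ((y, p.2) \in Q)]].

Definition cdiag X : corr X X := [set p : X * X | p.1 == p.2].

Lemma ccompP Z Y X (S : corr Z Y) (Q : corr Y X) z x :
  reflect (exists2 y, (z, y) \in S & (y, x) \in Q) ((z, x) \in ccomp S Q).
Proof.
rewrite inE /=; apply: (iffP existsP) => [[y /andP[]]|[y h1 h2]]; exists y => //.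
by rewrite h1.
Qed.

Lemma ccompA W Z Y X (P : corr W Z) (S : corr Z Y) (Q : corr Y X) :
  ccomp P (ccomp S Q) = ccomp (ccomp P S) Q.
Proof.
apply/setP => -[w x]; apply/ccompP/ccompP => [[z h /ccompP[y h1 h2]]|].
  by exists y => //; apply/ccompP; exists z.
by case=> y /ccompP[z h h1 h2]; exists z => //; apply/ccompP; exists y.
Qed.

Lemma ccomp1 Y X (S : corr Y X) : ccomp (cdiag Y) S = S.
Proof.
apply/setP => -[y x]; apply/ccompP/idP => [[z]|h]; last by exists y; rewrite ?inE.
by rewrite inE /= => /eqP ->.
Qed.

Lemma c1comp Y X (S : corr Y X) : ccomp S (cdiag X) = S.
Proof.
apply/setP => -[y x]; apply/ccompP/idP => [[z h]|h]; last by exists x; rewrite ?inE.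
by rewrite inE /= => /eqP <-.
Qed.

Definition cmon E : Type := corr E E.

HB.instance Definition _ E := Finite.on (cmon E).
HB.instance Definition _ E := isMonoid.Build (cmon E)
  (@ccompA E E E E) (@ccomp1 E E) (@c1comp E E).

End Correspondences.

Section LinearCorrespondences.
Variable k : fieldType.
Implicit Types E X Y Z : finType.

Definition kC Y X : Type := kfree k (corr Y X).

HB.instance Definition _ Y X := GRing.Lmodule.on (kC Y X).

Definition kcomp Z Y X : kC Z Y -> kC Y X -> kC Z X :=
  kbil (fun S Q => kbase (ccomp S Q) : kC Z X).

Lemma kcompA X Y Z W (x : kC W Z) (y : kC Z Y) (z : kC Y X) :
  kcomp (kcomp x y) z = kcomp x (kcomp y z).
Proof. by apply: kbilA => i j l; rewrite !kbilE ccompA. Qed.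

(* Its product is [kcomp] on kC E E. *)
Definition kCalg E := kmon k (cmon E).

Lemma kcomp1 X E (x : kC X E) : kcomp x (1 : kCalg E) = x.
Proof.
rewrite /kcomp /kbil [RHS]kfree_sum /kext; apply: eq_bigr => i _.
by rewrite -/(kext _ _) kextE c1comp.
Qed.

Definition kC_ract X E (x : kC X E) (a : kCalg E) : kC X E := kcomp x a.

Lemma kC_ractDl X E (x y : kC X E) a :
  kC_ract (x + y) a = kC_ract x a + kC_ract y a.
Proof. exact: kbilDl. Qed.

Lemma kC_ractDr X E (x : kC X E) a b :
  kC_ract x (a + b) = kC_ract x a + kC_ract x b.
Proof. exact: kbilDr. Qed.

Lemma kC_ractM X E (x : kC X E) a b :
  kC_ract x (a * b) = kC_ract (kC_ract x a) b.
Proof. by rewrite /kC_ract kcompA. Qed.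

Lemma kC_ractZ X E c (x : kC X E) a : kC_ract (c *: x) a = c *: kC_ract x a.
Proof. exact: kbilZl. Qed.

Definition kC_bimod X E : bimod k (kCalg E) :=
  Bimod (@kC_ractDl X E) (@kC_ractDr X E) (@kcomp1 X E) (@kC_ractM X E)
    (@kC_ractZ X E).

End LinearCorrespondences.

Section Functors.
Variables (k : fieldType) (E : finType).

Section LeftModule.
Variable W : lmodType (kCalg k E).

Definition Lfun (X : finType) := tensor (kC_bimod k X E) W.

HB.instance Definition _ X := GRing.Lmodule.on (Lfun X).

Definition Jfun (X : finType) : {pred Lfun X} := fun t =>
  `[< exists s : seq (kC_bimod k X E * W), t = \sum_(p <- s) p.1 \ox p.2 /\
      forall rho : kC k E X,
        \sum_(p <- s) (kcomp rho p.1 : kCalg k E) *: p.2 = 0 >].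

Lemma Jfun_closed X : GRing.submod_closed (@Jfun X).
Proof.
split; first by apply/asboolP; exists [::]; split => [|rho]; rewrite !big_nil.
move=> a s t /asboolP[ss [-> hs]] /asboolP[tt [-> ht]]; apply/asboolP.
exists ([seq (a *: p.1, p.2) | p <- ss] ++ tt); split => [|rho].
  rewrite big_cat big_map scaler_sumr; congr (_ + _); apply: eq_bigr => p _.
  by rewrite tpureZ.
rewrite big_cat big_map /= ht addr0.
under eq_bigr => p _ do rewrite /kcomp kbilZr -kbilZl -/(kcomp _ _).
exact: hs.
Qed.

Definition Sfun (X : finType) := lquot (@Jfun_closed X).

HB.instance Definition _ X := GRing.Lmodule.on (Sfun X).

Definition Sclass X (phi : kC_bimod k X E) (w : W) : Sfun X :=
  lproj (@Jfun_closed X) (phi \ox w).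

Definition Lact Y X (U : kC k Y X) : Lfun X -> Lfun Y :=
  tlift (fun (phi : kC_bimod k X E) w => (kcomp U phi : kC_bimod k Y E) \ox w).

Lemma Lact_bal Y X (U : kC k Y X) : balanced
  (fun (phi : kC_bimod k X E) (w : W) => (kcomp U phi : kC_bimod k Y E) \ox w).
Proof.
split=> [phi psi w|phi w w'|phi a w]; first by rewrite /kcomp kbilDr -tpureDl.
  by rewrite tpureDr.
by rewrite -tpure_bal; congr (_ \ox _); rewrite /= /kC_ract kcompA.
Qed.

Lemma LactE Y X (U : kC k Y X) (phi : kC_bimod k X E) (w : W) :
  Lact U (phi \ox w) = (kcomp U phi : kC_bimod k Y E) \ox w.
Proof. exact: (tliftE (Lact_bal U)). Qed.

HB.instance Definition _ Y X (U : kC k Y X) := GRing.isZmodMorphism.Build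
  (Lfun X) (Lfun Y) (Lact U) (tlift_is_zmod_morphism (Lact_bal U)).

Definition Sact Y X (U : kC k Y X) : Sfun X -> Sfun Y :=
  llift (fun t => lproj (@Jfun_closed Y) (Lact U t)).

Lemma Lact_Jfun Y X (U : kC k Y X) t : t \in @Jfun X -> Lact U t \in @Jfun Y.
Proof.
move=> /asboolP[s [-> hs]]; apply/asboolP.
exists [seq ((kcomp U p.1 : kC_bimod k Y E), p.2) | p <- s]; split => [|rho].
  by rewrite raddf_sum big_map; apply: eq_bigr => p _; rewrite /= LactE.
rewrite big_map -[RHS](hs (kcomp rho U)); apply: eq_bigr => p _ /=.
by rewrite kcompA.
Qed.

Lemma SactE Y X (U : kC k Y X) phi w :
  Sact U (Sclass phi w) = Sclass (kcomp U phi) w.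
Proof.
rewrite /Sact /Sclass lliftE ?LactE // => s t h; apply/lprojP.
by rewrite -raddfB; apply: Lact_Jfun.
Qed.

End LeftModule.

Section Bimodule.
Variables (B : nzRingType) (P : bimod (kCalg k E) B) (X : finType).

Definition Sract (s : Sfun P X) (b : B) : Sfun P X :=
  llift (fun t : Lfun P X => lproj (@Jfun_closed P X) (tensor_ract t b)) s.

Lemma tensor_ract_Jfun t b :
  t \in @Jfun P X -> tensor_ract (t : Lfun P X) b \in @Jfun P X.
Proof.
move=> /asboolP[s [-> hs]]; apply/asboolP.
exists [seq (p.1, ract p.2 b) | p <- s]; split => [|rho].
  rewrite big_map; elim: (s) => [|p s' ih]; first by rewrite !big_nil tensor_ract0.
  by rewrite !big_cons tensor_ractDl tensor_ractE ih.
have ract0 : ract (0 : P) b = 0.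
  by apply: (addrI (ract (0 : P) b)); rewrite -ractDl !addr0.
rewrite big_map -[RHS]ract0 -[in RHS](hs rho).
elim: (s) => [|p s' ih]; first by rewrite !big_nil ract0.
by rewrite !big_cons ractDl -ih ractZ.
Qed.

Lemma SractE t b : Sract (lproj (@Jfun_closed P X) t) b =
  lproj (@Jfun_closed P X) (tensor_ract (t : Lfun P X) b).
Proof.
rewrite /Sract lliftE // => u v h; apply/lprojP.
by rewrite -tensor_ractB; apply: tensor_ract_Jfun.
Qed.

Lemma SractDl s t b : Sract (s + t) b = Sract s b + Sract t b.
Proof.
elim/lquotW: s => s; elim/lquotW: t => t.
by rewrite -lprojD !SractE tensor_ractDl lprojD.
Qed.

Lemma SractDr s b c : Sract s (b + c) = Sract s b + Sract s c.
Proof. by elim/lquotW: s => s; rewrite !SractE tensor_ractDr lprojD. Qed.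

Lemma Sract1 s : Sract s 1 = s.
Proof. by elim/lquotW: s => s; rewrite !SractE tensor_ract1. Qed.

Lemma SractM s b c : Sract s (b * c) = Sract (Sract s b) c.
Proof. by elim/lquotW: s => s; rewrite !SractE tensor_ractM. Qed.

Lemma SractZ a s b : Sract (a *: s) b = a *: Sract s b.
Proof. by elim/lquotW: s => s; rewrite -linearZ !SractE -linearZ tensor_ractZ. Qed.

Definition Sfun_bimod : bimod k B :=
  Bimod SractDl SractDr Sract1 SractM SractZ.

Variable V : lmodType B.

Definition Psi : tensor Sfun_bimod V -> Sfun (tensor P V) X :=
  tlift (fun (s : Sfun_bimod) v => llift (fun t : Lfun P X =>
    tlift (fun phi (m : P) => Sclass phi (m \ox v)) t) s).

Lemma Psi_inner_bal (v : V) :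
  balanced (fun (phi : kC_bimod k X E) (m : P) => Sclass phi (m \ox v)).
Proof.
split=> [phi psi m|phi m m'|phi a m]; rewrite /Sclass.
- by rewrite tpureDl lprojD.
- by rewrite tpureDl tpureDr lprojD.
- by rewrite tpure_bal tpureZ.
Qed.

Lemma Psi_inner_const (v : V) (t u : Lfun P X) : t - u \in @Jfun P X ->
  tlift (fun phi (m : P) => Sclass phi (m \ox v)) t =
  tlift (fun phi (m : P) => Sclass phi (m \ox v)) u.
Proof.
move=> h; apply/eqP; rewrite -subr_eq0.
rewrite -(tliftB (Psi_inner_bal v)); apply/eqP.
move/asboolP: h => [s [-> hs]].
have -> : tlift (fun phi (m : P) => Sclass phi (m \ox v))
    (\sum_(p <- s) p.1 \ox p.2) =
    lproj (@Jfun_closed (tensor P V) X) (\sum_(p <- s) p.1 \ox (p.2 \ox v)).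
  rewrite linear_sum (tlift_sum (Psi_inner_bal v)); apply: eq_bigr => p _.
  by rewrite (tliftE (Psi_inner_bal v)).
rewrite -(raddf0 (lproj (@Jfun_closed (tensor P V) X))); apply/lprojP.
rewrite subr0; apply/asboolP.
exists [seq (p.1, p.2 \ox v) | p <- s]; split => [|rho]; first by rewrite big_map.
have t0 : (0 : P) \ox v = 0 by apply: (addrI (0 \ox v)); rewrite -tpureDl !addr0.
rewrite big_map -[RHS]t0 -[in RHS](hs rho).
elim: (s) => [|p s' ih]; first by rewrite !big_nil t0.
by rewrite !big_cons tpureDl -ih tpureZ.
Qed.

Lemma Psi_outer_bal : balanced (fun (s : Sfun_bimod) (v : V) =>
  llift (fun t : Lfun P X => tlift (fun phi (m : P) => Sclass phi (m \ox v)) t) s).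
Proof.
split=> [s t v|s v w|s b v].
- elim/lquotW: s => s; elim/lquotW: t => t.
  rewrite -[_ + _ : Sfun_bimod]/(lproj _ s + lproj _ t) -lprojD.
  rewrite !lliftE; try exact: Psi_inner_const.
  exact: (tliftD (Psi_inner_bal v)).
- elim/lquotW: s => s; rewrite !lliftE; try exact: Psi_inner_const.
  elim/(@tensor_ind _ _ (kC_bimod k X E) P): s => [phi m||s t hs ht].
  + by rewrite !(tliftE (Psi_inner_bal _)) /Sclass !tpureDr lprojD.
  + by rewrite !(tlift0 (Psi_inner_bal _)) addr0.
  + by rewrite !(tliftB (Psi_inner_bal _)) hs ht opprD addrACA.
- elim/lquotW: s => s; rewrite /= SractE !lliftE; try exact: Psi_inner_const.
  elim/(@tensor_ind _ _ (kC_bimod k X E) P): s => [phi m||s t hs ht].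
  + by rewrite tensor_ractE !(tliftE (Psi_inner_bal _)) tpure_bal.
  + by rewrite tensor_ract0 !(tlift0 (Psi_inner_bal _)).
  + by rewrite tensor_ractB !(tliftB (Psi_inner_bal _)) hs ht.
Qed.

Lemma PsiE phi m (v : V) :
  Psi ((Sclass phi m : Sfun_bimod) \ox v) = Sclass phi (m \ox v).
Proof.
rewrite /Psi (tliftE Psi_outer_bal) /Sclass lliftE ?(tliftE (Psi_inner_bal v)) //.
exact: Psi_inner_const.
Qed.

End Bimodule.

End Functors.

Record porel (E : finType) := PORel {
  po_rel :> rel E;
  po_refl : reflexive po_rel;
  po_anti : antisymmetric po_rel;
  po_trans : transitive po_rel
}.

Section OppositeOrder.
Variables (E : finType) (R : porel E).

Definition oprel : rel E := fun e f => R f e.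

Lemma oprel_refl : reflexive oprel.
Proof. by move=> e; apply: po_refl. Qed.

Lemma oprel_anti : antisymmetric oprel.
Proof. by move=> e f; rewrite andbC; apply: po_anti. Qed.

Lemma oprel_trans : transitive oprel.
Proof. by move=> f e g h1 h2; apply: po_trans h2 h1. Qed.

Definition po_op : porel E := PORel oprel_refl oprel_anti oprel_trans.

End OppositeOrder.

Section Automorphisms.
Variables (E : finType) (R : porel E).

Record aut := Aut {
  aut_perm :> {perm E};
  _ : [forall x, forall y, R (aut_perm x) (aut_perm y) == R x y]
}.

HB.instance Definition _ := [isSub for aut_perm].
HB.instance Definition _ := [Finite of aut by <:].

Lemma autP (s : aut) x y : R (s x) (s y) = R x y.
Proof. by apply/eqP; case: s => s /= /forallP /(_ x) /forallP. Qed.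

(* The product is the composition of maps: (s * t) x = s (t x). This is the   *)
(* opposite of the product of permutations.                                   *)
Lemma aut_mul_subproof (s t : aut) :
  [forall x, forall y,
    R ((aut_perm t * aut_perm s)%g x) ((aut_perm t * aut_perm s)%g y) == R x y].
Proof. by apply/forallP => x; apply/forallP => y; rewrite !permM !autP. Qed.

Definition aut_mul (s t : aut) : aut := Aut (aut_mul_subproof s t).

Lemma aut_one_subproof :
  [forall x, forall y, R ((1%g : {perm E}) x) ((1%g : {perm E}) y) == R x y].
Proof. by apply/forallP => x; apply/forallP => y; rewrite !perm1. Qed.

Definition aut_one : aut := Aut aut_one_subproof.

Lemma aut_mulA : associative aut_mul.
Proof. by move=> s t u; apply: val_inj; rewrite /= mulgA. Qed.

Lemma aut_mul1 : left_id aut_one aut_mul.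
Proof. by move=> s; apply: val_inj; rewrite /= mulg1. Qed.

Lemma aut_1mul : right_id aut_one aut_mul.
Proof. by move=> s; apply: val_inj; rewrite /= mul1g. Qed.

HB.instance Definition _ := isMonoid.Build aut aut_mulA aut_mul1 aut_1mul.

Lemma autME (s t : aut) x : (s * t)%g x = s (t x).
Proof. by rewrite /= permM. Qed.

Lemma aut1E x : (1%g : aut) x = x.
Proof. by rewrite /= perm1. Qed.

End Automorphisms.

Definition kAut (k : fieldType) (E : finType) (R : porel E) := kmon k (aut R).

Lemma aut_opP (E : finType) (R : porel E) (s : {perm E}) :
  [forall x, forall y, po_op R (s x) (s y) == po_op R x y] =
  [forall x, forall y, R (s x) (s y) == R x y].
Proof.
by apply/forallP/forallP => h x; apply/forallP => y;
   have /forallP := h y; apply.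
Qed.

(* The kC(E, E)-module P_E f_R; the order R occurs only in the module         *)
(* structure below.                                                           *)
Definition PEf (k : fieldType) (E : finType) (R : porel E) : Type :=
  kfree k {perm E}.

Section FundamentalModule.
Variables (k : fieldType) (E : finType) (R : porel E).

Implicit Types (alpha beta gamma : {perm E}) (Q : corr E E).

Definition Delta (alpha : {perm E}) : corr E E := [set p : E * E | p.1 == alpha p.2].

Definition conj_rel (alpha : {perm E}) : corr E E :=
  [set (alpha p.1, alpha p.2) | p in [set p : E * E | R p.1 p.2]].

Definition pf_witness (Q : corr E E) (alpha beta : {perm E}) : bool :=
  (cdiag E \subset ccomp (Delta beta^-1%g) Q) &&
  (ccomp (Delta beta^-1%g) Q \subset conj_rel alpha).

(* The basis vector Delta_alpha f_R is [kbase alpha]; the map beta alpha is   *)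
(* the product [alpha * beta] of {perm E}.                                    *)
Definition pf_act (Q : cmon E) (alpha : {perm E}) : kfree k {perm E} :=
  if [pick beta | pf_witness Q alpha beta] is Some beta
  then kbase (alpha * beta)%g else 0.

Lemma conj_relP alpha x y :
  ((x, y) \in conj_rel alpha) = R ((alpha^-1)%g x) ((alpha^-1)%g y).
Proof.
apply/imsetP/idP => [[[e f]]|h].
  by rewrite inE /= => h [-> ->]; rewrite !permK.
by exists ((alpha^-1)%g x, (alpha^-1)%g y); rewrite ?inE //= !permKV.
Qed.

Lemma comp_DeltaV beta (Q : corr E E) z x :
  ((z, x) \in ccomp (Delta beta^-1%g) Q) = ((beta z, x) \in Q).
Proof.
apply/ccompP/idP => [[y]|h]; last by exists (beta z); rewrite ?inE //= permK.
by rewrite inE /= => /eqP ->; rewrite permKV.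
Qed.

Lemma pf_witnessP Q alpha beta : reflect
  ((forall e, (beta e, e) \in Q) /\ (forall z x, (beta z, x) \in Q ->
      R ((alpha^-1)%g z) ((alpha^-1)%g x)))
  (pf_witness Q alpha beta).
Proof.
apply: (iffP andP) => [[/subsetP h1 /subsetP h2]|[h1 h2]]; split.
- by move=> e; rewrite -comp_DeltaV; apply: h1; rewrite inE.
- by move=> z x h; rewrite -conj_relP; apply: h2; rewrite comp_DeltaV.
- by apply/subsetP => -[x y]; rewrite inE /= => /eqP ->; rewrite comp_DeltaV.
- by apply/subsetP => -[z x]; rewrite comp_DeltaV conj_relP; apply: h2.
Qed.

Lemma pf_witness_uniq Q alpha beta beta' :
  pf_witness Q alpha beta -> pf_witness Q alpha beta' -> beta = beta'.
Proof.
move=> /pf_witnessP[h1 h2] /pf_witnessP[h1' h2']; apply/permP => e.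
have le (g g' : {perm E}) e' : (forall e, (g e, e) \in Q) ->
    (forall z x, (g' z, x) \in Q -> R ((alpha^-1)%g z) ((alpha^-1)%g x)) ->
    R ((alpha^-1)%g ((g'^-1)%g (g e'))) ((alpha^-1)%g e').
  by move=> hg hg'; apply: hg'; rewrite permKV.
have l1 := le beta beta' e h1 h2'.
have := le beta' beta ((beta'^-1)%g (beta e)) h1' h2; rewrite permKV permK => l2.
have /perm_inj e1 := po_anti (introT andP (conj l1 l2)).
by rewrite -[in RHS]e1 permKV.
Qed.

Lemma pf_actT Q alpha beta : pf_witness Q alpha beta ->
  pf_act Q alpha = kbase (alpha * beta)%g.
Proof.
move=> h; rewrite /pf_act; case: pickP => [b hb|/(_ beta)]; last by rewrite h.
by rewrite (pf_witness_uniq h hb).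
Qed.

Lemma pf_actF Q alpha : (forall beta, ~~ pf_witness Q alpha beta) ->
  pf_act Q alpha = 0.
Proof.
by move=> h; rewrite /pf_act; case: pickP => // b; rewrite (negbTE (h b)).
Qed.

Lemma pf_act1 alpha : pf_act 1%g alpha = kbase alpha.
Proof.
rewrite (@pf_actT _ _ 1%g) ?mulg1 //; apply/pf_witnessP; split=> [e|z x].
  by rewrite perm1 inE.
by rewrite perm1 inE /= => /eqP ->; apply: po_refl.
Qed.

Lemma pf_witnessM (Q Q' : corr E E) alpha beta beta' :
  pf_witness Q' alpha beta' -> pf_witness Q (alpha * beta')%g beta ->
  pf_witness (ccomp Q Q') alpha (beta' * beta)%g.
Proof.
move=> /pf_witnessP[h1' h2'] /pf_witnessP[h1 h2].
apply/pf_witnessP; split=> [e|z x].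
  by rewrite permM; apply/ccompP; exists (beta' e).
rewrite permM => /ccompP[y /h2 hy].
rewrite -[y](permKV beta') in hy * => /h2'; apply: po_trans.
by move: hy; rewrite invgM !permM !permK.
Qed.

Lemma pf_witnessM_inv (Q Q' : corr E E) alpha gamma : pf_witness (ccomp Q Q') alpha gamma ->
  exists beta' beta,
    pf_witness Q' alpha beta' /\ pf_witness Q (alpha * beta')%g beta.
Proof.
move=> /pf_witnessP[h1 h2].
have hy e : {y | ((gamma e, y) \in Q) && ((y, e) \in Q')}.
  by apply: sigW; have /ccompP[y y1 y2] := h1 e; exists y; rewrite y1.
pose y e := sval (hy e).
have yQ e : (gamma e, y e) \in Q by have /andP[] := svalP (hy e).
have yQ' e : (y e, e) \in Q' by have /andP[] := svalP (hy e).
have y_inj : injective y.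
  move=> e f ef; apply: (@perm_inj _ (alpha^-1)%g).
  apply: (@po_anti _ R); rewrite !h2 //; apply/ccompP.
    by exists (y e) => //; rewrite ef.
  by exists (y f) => //; rewrite -ef.
pose b' := perm y_inj; exists b', (b'^-1 * gamma)%g.
have yb e : y ((b'^-1)%g e) = e by rewrite -[LHS](permE y_inj) permKV.
split; apply/pf_witnessP; split=> [e|z x].
- by rewrite permE.
- by rewrite permE => h; apply: h2; apply/ccompP; exists (y z).
- by rewrite permM -{2}[e]yb.
- rewrite permM invgM !permM => h; apply: h2; apply/ccompP; exists x => //.
  by rewrite -{1}[x]yb.
Qed.

Lemma pf_actM (Q Q' : cmon E) alpha :
  pf_act (Q * Q')%g alpha = kext (pf_act Q) (pf_act Q' alpha).
Proof.
have [/existsP[b' hb']|/existsPn h'] := boolP [exists b, pf_witness Q' alpha b].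
  rewrite (pf_actT hb') kextE.
  have [/existsP[b hb]|/existsPn h] :=
      boolP [exists b, pf_witness Q (alpha * b')%g b].
    by rewrite (pf_actT hb) (pf_actT (pf_witnessM hb' hb)) mulgA.
  rewrite (pf_actF h) pf_actF // => c; apply/negP => /pf_witnessM_inv[d [b [hd hb]]].
  by move: hb; rewrite -(pf_witness_uniq hb' hd) (negbTE (h b)).
rewrite (pf_actF h') linear0 pf_actF // => c; apply/negP.
by move=> /pf_witnessM_inv[d [b [hd _]]]; move: hd; rewrite (negbTE (h' d)).
Qed.

HB.instance Definition _ := GRing.Zmodule.on (PEf k R).

Definition PEf_scale (a : kCalg k E) (x : PEf k R) : PEf k R := kbil pf_act a x.

Lemma PEf_scaleA a b x : PEf_scale a (PEf_scale b x) = PEf_scale (a * b) x.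
Proof. by apply/esym/kbilA => Q Q' alpha; rewrite !kbilE pf_actM /kbil kextE. Qed.

Lemma PEf_scale1 : left_id 1 PEf_scale.
Proof.
move=> x; rewrite /PEf_scale /kbil kextE [RHS]kfree_sum /kext.
by apply: eq_bigr => alpha _; rewrite pf_act1.
Qed.

Lemma PEf_scaleDr : right_distributive PEf_scale +%R.
Proof. by move=> a x y; apply: kbilDr. Qed.

Lemma PEf_scaleDl x : {morph PEf_scale^~ x : a b / a + b}.
Proof. by move=> a b; apply: kbilDl. Qed.

HB.instance Definition _ := GRing.Zmodule_isLmodule.Build (kCalg k E)
  (PEf k R)
  PEf_scaleA PEf_scale1 PEf_scaleDr PEf_scaleDl.

End FundamentalModule.

(* P_E f_{R^op} as a right kAut(E, R)-module, Aut(E, R) being the same group  *)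
(* as Aut(E, R^op), see [aut_opP].                                            *)
Section FundamentalBimodule.
Variables (k : fieldType) (E : finType) (R : porel E).
Implicit Types (alpha beta : {perm E}) (tau : aut R).

Definition PEf_ract (x : PEf k (po_op R)) (a : kAut k R) : PEf k (po_op R) :=
  kbil (fun alpha tau => kbase (aut_perm tau * alpha)%g : kfree k {perm E}) x a.

Lemma PEf_ractDl x y a : PEf_ract (x + y) a = PEf_ract x a + PEf_ract y a.
Proof. exact: kbilDl. Qed.

Lemma PEf_ractDr x a b : PEf_ract x (a + b) = PEf_ract x a + PEf_ract x b.
Proof. exact: kbilDr. Qed.

Lemma PEf_ract1 x : PEf_ract x 1 = x.
Proof.
rewrite /PEf_ract /kbil [RHS]kfree_sum /kext; apply: eq_bigr => i _.
by rewrite -/(kext _ _) kextE /= mul1g.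
Qed.

Lemma PEf_ractM x a b : PEf_ract x (a * b) = PEf_ract (PEf_ract x a) b.
Proof.
by apply/esym/kbilA => alpha s t; rewrite !kbilE /= mulgA.
Qed.

Lemma pf_witness_aut Q alpha tau beta :
  pf_witness (po_op R) Q (aut_perm tau * alpha)%g beta =
  pf_witness (po_op R) Q alpha beta.
Proof.
rewrite /pf_witness; suff -> : conj_rel (po_op R) (aut_perm tau * alpha)%g =
    conj_rel (po_op R) alpha by [].
apply/setP => -[x y]; rewrite !conj_relP invgM !permM /= /oprel.
by rewrite -(autP tau) !permKV.
Qed.

Lemma pf_act_aut (Q : cmon E) alpha tau :
  pf_act k (po_op R) Q (aut_perm tau * alpha)%g =
  PEf_ract (pf_act k (po_op R) Q alpha) (kbase tau).
Proof.
rewrite {1}/pf_act (eq_pick (pf_witness_aut Q alpha tau)) /pf_act.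
by case: pickP => [b _|_]; rewrite /PEf_ract ?kbilE ?mulgA ?kbil0l.
Qed.

Lemma PEf_ractZ (a : kCalg k E) x b : PEf_ract (a *: x) b = a *: PEf_ract x b.
Proof.
apply: kbilA => Q alpha t; rewrite /kbil !kextE -/(kbil _ _ _).
exact/esym/pf_act_aut.
Qed.

Definition PEf_bimod : bimod (kCalg k E) (kAut k R) :=
  Bimod PEf_ractDl PEf_ractDr PEf_ract1 PEf_ractM PEf_ractZ.

Definition SEop (X : finType) : bimod k (kAut k R) := Sfun_bimod PEf_bimod X.

Definition SEopV (V : lmodType (kAut k R)) (X : finType) :=
  Sfun (tensor PEf_bimod V) X.

HB.instance Definition _ V X := GRing.Lmodule.on (SEopV V X).

End FundamentalBimodule.

Definition simple_lmodule (A : nzRingType) (V : lmodType A) : Prop :=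
  (exists v : V, v != 0) /\
  forall S : {pred V}, GRing.submod_closed S -> S =i pred1 0 \/ S =i predT.

Section Lattice.
Variables (d : Order.disp_t) (T : finTBLatticeType d).
Implicit Types (a b t : T) (A : {set T}).
Local Open Scope order_scope.

Definition irreducible t : bool :=
  [forall A : {set T}, (t == \join_(a in A) a) ==> (t \in A)].

Record irr := Irr { irr_val : T; irrP : irreducible irr_val }.

HB.instance Definition _ := [isSub for irr_val].
HB.instance Definition _ := [Finite of irr by <:].

Definition lat_rel : rel T := fun a b => a <= b.

Lemma lat_rel_anti : antisymmetric lat_rel.
Proof. exact: le_anti. Qed.

Lemma lat_rel_trans : transitive lat_rel.
Proof. exact: le_trans. Qed.

Definition lat_le : porel T := PORel (@lexx _ T) lat_rel_anti lat_rel_trans.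

Definition irr_rel : rel irr := fun e f => irr_val e <= irr_val f.

Lemma irr_rel_refl : reflexive irr_rel.
Proof. by move=> e; apply: lexx. Qed.

Lemma irr_rel_anti : antisymmetric irr_rel.
Proof. by move=> e f h; apply/val_inj/le_anti. Qed.

Lemma irr_rel_trans : transitive irr_rel.
Proof. by move=> f e g; apply: le_trans. Qed.

Definition irr_le : porel irr := PORel irr_rel_refl irr_rel_anti irr_rel_trans.

Lemma aut_le (s : aut lat_le) a b : (s a <= s b) = (a <= b).
Proof. exact: (autP s). Qed.

Lemma aut_lt (s : aut lat_le) a b : (s a < s b) = (a < b).
Proof. by rewrite !lt_neqAle aut_le (inj_eq perm_inj). Qed.

Lemma aut_leV (s : aut lat_le) a b : (s a <= b) = (a <= ((s : {perm T})^-1)%g b).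
Proof. by rewrite -[RHS](aut_le s) permKV. Qed.

Lemma aut_geV (s : aut lat_le) a b : (b <= s a) = (((s : {perm T})^-1)%g b <= a).
Proof. by rewrite -[RHS](aut_le s) permKV. Qed.

Lemma aut_join (s : aut lat_le) (P Q : pred T) : (forall x, P (s x) = Q x) ->
  s (\join_(x | Q x) x) = \join_(x | P x) x.
Proof.
move=> h; apply/le_anti/andP; split.
  rewrite aut_leV; apply/joinsP => x hx; rewrite -aut_leV.
  by apply: (@joins_sup _ _ _ (s x) P id); rewrite h.
apply/joinsP => x hx; rewrite aut_geV.
by apply: (@joins_sup _ _ _ _ Q id); rewrite -h permKV.
Qed.

Lemma aut_meet (s : aut lat_le) (P Q : pred T) : (forall x, P (s x) = Q x) ->
  s (\meet_(x | Q x) x) = \meet_(x | P x) x.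
Proof.
move=> h; apply/le_anti/andP; split.
  apply/meetsP => x hx; rewrite aut_leV.
  by apply: (@meets_inf _ _ _ _ Q id); rewrite -h permKV.
rewrite aut_geV; apply/meetsP => x hx; rewrite -aut_geV.
by apply: (@meets_inf _ _ _ (s x) P id); rewrite h.
Qed.

Lemma aut_irr (s : aut lat_le) t : irreducible (s t) = irreducible t.
Proof.
apply/forallP/forallP => h A; apply/implyP => /eqP e.
  rewrite -(mem_imset _ _ (@perm_inj _ s)); apply: (implyP (h (s @: A))).
  rewrite [in X in X == _]e (@aut_join s (mem (s @: A))) // => x.
  exact: (mem_imset _ _ (@perm_inj _ s)).
have h' := implyP (h (s @^-1: A)); rewrite inE in h'; apply: h'.
apply/eqP/(@perm_inj _ s); rewrite [LHS]e.
by rewrite (@aut_join s (mem A)) // => x; rewrite !inE.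
Qed.

Lemma aut_restr_irr (s : aut lat_le) (e : irr) : irreducible (s (irr_val e)).
Proof. by rewrite aut_irr irrP. Qed.

Definition aut_restr_fun (s : aut lat_le) (e : irr) : irr :=
  Irr (aut_restr_irr s e).

Lemma aut_restr_inj s : injective (aut_restr_fun s).
Proof. by move=> e f [] /perm_inj /val_inj. Qed.

Lemma aut_restr_subproof s : [forall x, forall y,
  irr_le (perm (@aut_restr_inj s) x) (perm (@aut_restr_inj s) y) == irr_le x y].
Proof.
apply/forallP => x; apply/forallP => y.
by rewrite !permE /= /irr_rel /= aut_le.
Qed.

Definition aut_restr (s : aut lat_le) : aut irr_le := Aut (aut_restr_subproof s).

Lemma aut_restrE s e : irr_val (aut_restr s e) = s (irr_val e).
Proof. by rewrite /= permE. Qed.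

Lemma aut_restrM (s t : aut lat_le) : aut_restr (s * t)%g = (aut_restr s * aut_restr t)%g.
Proof.
apply/val_inj/permP => e; apply: val_inj.
by rewrite autME [LHS]aut_restrE autME [RHS]aut_restrE aut_restrE.
Qed.

Lemma aut_restr1 : aut_restr 1%g = 1%g.
Proof.
apply/val_inj/permP => e; apply: val_inj.
by rewrite aut1E [LHS]aut_restrE aut1E.
Qed.

Definition lat_r t : T := \join_(x | x < t) x.

Definition lat_sigma t : T := \meet_(x | irreducible x && (t < x)) x.

(* The iterates are monotone sequences in T, hence stable after #|T| steps.   *)
Definition lat_rinf t : T := iter #|T| lat_r t.

Definition lat_sinf t : T := iter #|T| lat_sigma t.

(* r^oo (sigma^oo (t)) *)
Definition lat_b t : T := lat_rinf (lat_sinf t).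

Definition lat_G : {set T} := [set a | irreducible a || (a == lat_b a)].

Definition lat_Gc : {set T} := ~: lat_G.

Lemma aut_r (s : aut lat_le) t : lat_r (s t) = s (lat_r t).
Proof. by apply/esym/aut_join => x; rewrite aut_lt. Qed.

Lemma aut_sigma (s : aut lat_le) t : lat_sigma (s t) = s (lat_sigma t).
Proof. by apply/esym/aut_meet => x; rewrite aut_irr aut_lt. Qed.

Lemma aut_b (s : aut lat_le) t : lat_b (s t) = s (lat_b t).
Proof.
have it f (hf : forall u, f (s u) = s (f u)) n u : iter n f (s u) = s (iter n f u).
  by elim: n => //= n ->.
by rewrite /lat_b /lat_sinf it ?/lat_rinf ?it //; [apply: aut_r|apply: aut_sigma].
Qed.

Lemma aut_G (s : aut lat_le) t : (s t \in lat_G) = (t \in lat_G).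
Proof. by rewrite !inE aut_irr aut_b (inj_eq perm_inj). Qed.

End Lattice.

Section LatticeMaps.
Variables (k : fieldType) (d : Order.disp_t) (T : finTBLatticeType d).
Implicit Types X Y : finType.
Local Open Scope order_scope.

(* k(T^X) *)
Definition kmap X : Type := kfree k {ffun X -> T}.

HB.instance Definition _ X := GRing.Lmodule.on (kmap X).

Definition kmap_comp X (u : kmap T) (x : kmap X) : kmap X :=
  kbil (fun (f : {ffun T -> T}) (phi : {ffun X -> T}) =>
    kbase [ffun i => f (phi i)] : kmap X) u x.

(* [c_0, ..., c_n] *)
Definition bracket (c : seq T) : {ffun T -> T} :=
  [ffun x => let i := index x c in
     if (i.+1 < size c)%N then nth x c i.+1 else x].

(* a < sigma a < ... < sigma^r a < b <= sigma^(r+1) a *)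
Definition u_fits (a : T) (r : nat) : bool :=
  [&& [forall j : 'I_r, iter j (@lat_sigma _ T) a < iter j.+1 (@lat_sigma _ T) a],
      iter r (@lat_sigma _ T) a < lat_b a
    & lat_b a <= iter r.+1 (@lat_sigma _ T) a].

(* Such an r is smaller than #|T|, and is unique, when a is in G^c.           *)
Definition u_rank (a : T) : nat := find (u_fits a) (iota 0 #|T|).

(* (a_0, ..., a_(r+1)) *)
Definition u_chain (a : T) : seq T :=
  rcons (traject (@lat_sigma _ T) a (u_rank a).+1) (lat_b a).

Definition u_elt (a : T) : kmap T :=
  \sum_(j < (u_rank a).+1)
    ((-1) ^+ j : k)%R *: (kbase (bracket (take j.+2 (u_chain a))) : kmap T).

Definition u_comp (s : seq T) : kmap T :=
  foldr (fun a x => kmap_comp (u_elt a) x) (kbase [ffun x => x]) s.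

Definition covers_irr X (phi : {ffun X -> T}) : bool :=
  [forall e : irr T, irr_val e \in codom phi].

Definition lat_pi X : kmap X -> kmap X :=
  kext (fun phi => if covers_irr phi then kbase phi else 0%R).

Definition cact Y X (U : corr Y X) (phi : {ffun X -> T}) : {ffun Y -> T} :=
  [ffun y => \join_(x | (y, x) \in U) phi x].

Definition Gam X (phi : {ffun X -> T}) : corr X (irr T) :=
  [set p : X * irr T | irr_val p.2 <= phi p.1].

(* [kbase 1] is the generator f_{R^op}. *)
Definition Theta X : kmap X -> SEop k (irr_le T) X :=
  kext (fun phi => Sclass (kbase (Gam phi) : kC_bimod k X (irr T))
                          (kbase (1%g : {perm irr T}) : PEf k (po_op (irr_le T)))).

Record Bmap X := BMap {
  Bmap_val : {ffun X -> T};
  BmapP : covers_irr Bmap_val && [forall x, Bmap_val x \in lat_G T]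
}.

HB.instance Definition _ X := [isSub for @Bmap_val X].
HB.instance Definition _ X := [Finite of Bmap X by <:].

Definition kB X : Type := kfree k (Bmap X).

HB.instance Definition _ X := GRing.Lmodule.on (kB X).

Definition kB_incl X : kB X -> kmap X :=
  kext (fun phi : Bmap X => kbase (Bmap_val phi) : kmap X).

(* The automorphism of T extending tau, when restriction is bijective.        *)
Definition aut_ext (tau : aut (irr_le T)) : aut (lat_le T) :=
  odflt 1%g [pick s | aut_restr s == tau].

Lemma Bmap_act_subproof X (phi : Bmap X) (s : aut (lat_le T)) :
  let psi := [ffun x => ((aut_perm s)^-1)%g (Bmap_val phi x)] in
  covers_irr psi && [forall x, psi x \in lat_G T].
Proof.
case: phi => phi /= /andP[/forallP h /forallP hG]; apply/andP; split.
  apply/forallP => e; have /codomP[x hx] := h (aut_restr s e).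
  by apply/codomP; exists x; rewrite ffunE -hx aut_restrE permK.
by apply/forallP => x; rewrite ffunE -(aut_G s) permKV.
Qed.

Definition Bmap_act X (phi : Bmap X) (tau : aut (irr_le T)) : Bmap X :=
  BMap (Bmap_act_subproof phi (aut_ext tau)).

Definition kB_ract X (x : kB X) (a : kAut k (irr_le T)) : kB X :=
  kbil (fun phi tau => kbase (Bmap_act phi tau) : kB X) x a.

Lemma kB_ractDl X (x y : kB X) a : (kB_ract (x + y) a = kB_ract x a + kB_ract y a)%R.
Proof. exact: kbilDl. Qed.

Lemma kB_ractDr X (x : kB X) a b : (kB_ract x (a + b) = kB_ract x a + kB_ract x b)%R.
Proof. exact: kbilDr. Qed.

Lemma kB_ractZ X c (x : kB X) a : (kB_ract (c *: x) a = c *: kB_ract x a)%R.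
Proof. exact: kbilZl. Qed.

Hypothesis hT : bijective (@aut_restr _ T).

Lemma aut_extK tau : aut_restr (aut_ext tau) = tau.
Proof.
case: hT => g _ gK; rewrite /aut_ext; case: pickP => [s /eqP //|/(_ (g tau))].
by rewrite gK eqxx.
Qed.

Lemma aut_ext1 : aut_ext 1%g = 1%g.
Proof. by apply: (bij_inj hT); rewrite aut_extK aut_restr1. Qed.

Lemma aut_extM s t : aut_ext (s * t)%g = (aut_ext s * aut_ext t)%g.
Proof. by apply: (bij_inj hT); rewrite aut_extK aut_restrM !aut_extK. Qed.

Lemma Bmap_act1 X (phi : Bmap X) : Bmap_act phi 1%g = phi.
Proof.
by apply/val_inj/ffunP => x; rewrite !ffunE aut_ext1 /= invg1 perm1.
Qed.

Lemma Bmap_actM X (phi : Bmap X) s t :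
  Bmap_act phi (s * t)%g = Bmap_act (Bmap_act phi s) t.
Proof.
by apply/val_inj/ffunP => x; rewrite !ffunE aut_extM /= invgM permM.
Qed.

Lemma kB_ract1 X (x : kB X) : kB_ract x 1%R = x.
Proof.
rewrite /kB_ract /kbil [RHS]kfree_sum /kext; apply: eq_bigr => phi _.
by rewrite -/(kext _ _) kextE Bmap_act1.
Qed.

Lemma kB_ractM X (x : kB X) a b : kB_ract x (a * b)%R = kB_ract (kB_ract x a) b.
Proof. by apply/esym/kbilA => phi s t; rewrite !kbilE Bmap_actM. Qed.

Definition kB_bimod X : bimod k (kAut k (irr_le T)) :=
  Bimod (@kB_ractDl X) (@kB_ractDr X) (@kB_ract1 X) (@kB_ractM X) (@kB_ractZ X).

End LatticeMaps.

(* Main.v *)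
Require Import Defs.
From HB Require Import structures.
From mathcomp Require Import all_boot all_order all_algebra perm.
From mathcomp Require Import boolp.

Set Implicit Arguments.
Unset Strict Implicit.
Unset Printing Implicit Defensive.

Import Order.TTheory GRing.Theory.
Local Open Scope ring_scope.

(** A map [phi] is seen by S_{E,R^op}(X) only through the numbers [hits Y phi],
    where Y assigns a subset Y_e of X to each irreducible e: [hits Y phi] says
    that phi <= e on Y_e and that phi takes the value e on Y_e. Indeed Q Gamma_phi
    acts on f_{R^op} by the permutation beta exactly when the rows Q_(beta e) hit phi.
    - Along a chain (a_0, ..., a_(r+1)) the sum over j of
      (-1)^j hits Y ([a_0, ..., a_j] phi) telescopes to 0. Hence phi and u_a phi,
      so also phi and pi (u_T phi), have the same image under Theta; this gives
      surjectivity and (b).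
    - For phi in B the functions Y |-> hits Y phi are independent, with coefficients
      in any abelian group: replace every value of phi by the bottom of its chain,
      take phi with this bottom map minimal, and then recover the fibers of phi over
      the irreducibles one by one, from the top down.
    - Each Q defines a linear form on S_{E,R^op,V}(X) with values in V that sends
      phi (x) v to the sum over tau of (hits Q (tau phi)) tau v. As Aut(E,R) acts
      freely on B, independence applied to a normal form of an element of
      kB (x) V gives injectivity. *)

(** Each step that moves the point lowers [m], so at most [m x] steps move it. The measure is the
    size of the down-set for r and of the up-set for sigma. *)
Lemma iter_stable (A : Type) (f : A -> A) (m : A -> nat) N x :
  (forall y, f y <> y -> (m (f y) < m y)%N) -> (m x <= N)%N ->
  f (iter N f x) = iter N f x.
Proof.
move=> hf hN; have : forall n, f (iter n f x) = iter n f x \/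
    (m (iter n f x) + n <= m x)%N.
  elim=> [|n [e|h]]; first by right; rewrite addn0.
    by left; rewrite /= !e.
  have [e|ne] := pselect (f (iter n f x) = iter n f x).
    by left; rewrite /= !e.
  right; apply: leq_trans h; rewrite addnS -addSn leq_add2r; exact: hf.
case/(_ N) => // h; have [//|ne] := pselect (f (iter N f x) = iter N f x).
have := hf _ ne; have : m (iter N f x) = 0%N.
  by apply/eqP; rewrite -leqn0 -(leq_add2r N) add0n (leq_trans h hN).
by move=> ->.
Qed.

(** * The operators r and sigma *)

Section LatticeTheory.
Variables (d : Order.disp_t) (T : finTBLatticeType d).
Implicit Types (a b c e f t x y : T).
Local Open Scope order_scope.

Lemma irr_join_ex (I : finType) (P : pred I) (F : I -> T) e :
  irreducible e -> \join_(i | P i) F i = e -> exists2 i, P i & F i = e.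
Proof.
move=> /forallP/(_ [set F i | i in P])/implyP h eF.
have /h/imsetP[i hi ->] : e == \join_(a in [set F i | i in P]) a.
  rewrite -eF; apply/eqP/le_anti/andP; split; apply/joinsP.
    by move=> i hi; apply: (@joins_sup _ _ _ (F i) _ id); apply: imset_f.
  by move=> _ /imsetP[i hi ->]; apply: joins_sup.
by exists i.
Qed.

Lemma lat_r_le t : lat_r t <= t.
Proof. by apply/joinsP => x /ltW. Qed.

Lemma le_lat_r x t : x < t -> x <= lat_r t.
Proof. by move=> h; apply: (@joins_sup _ _ _ _ _ id). Qed.

(** If t is the join of A and t is not in A, every member of A lies strictly below t, whence t <=
    r(t). *)
Lemma lat_r_irr t : irreducible t = (lat_r t < t).
Proof.
apply/idP/idP => [h|h].
  rewrite lt_neqAle lat_r_le andbT; apply/eqP => /(irr_join_ex h)[x].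
  by move=> h1 h2; move: h1; rewrite h2 ltxx.
apply/forallP => A; apply/implyP => /eqP eA; apply/negPn/negP => tA.
have /negP := negbT (lt_geF h); apply; rewrite [X in X <= _]eA.
apply/joinsP => x xA; apply: le_lat_r; rewrite lt_neqAle; apply/andP; split.
  by apply/eqP => e; rewrite -e xA in tA.
by rewrite eA; apply: (@joins_sup _ _ _ _ _ id).
Qed.

Lemma lat_r_id t : ~~ irreducible t -> lat_r t = t.
Proof. by rewrite lat_r_irr lt_neqAle lat_r_le andbT negbK => /eqP. Qed.

Lemma card_down_lt x y : x < y -> (#|[set z | (z <= x)%O]| < #|[set z | (z <= y)%O]|)%N.
Proof.
move=> h; apply: proper_card; apply/properP; split.
  by apply/subsetP => z; rewrite !inE => /le_trans; apply; apply: ltW.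
by exists y; rewrite inE ?lexx // lt_geF.
Qed.

Lemma card_up_lt x y : x < y -> (#|[set z | (y <= z)%O]| < #|[set z | (x <= z)%O]|)%N.
Proof.
move=> h; apply: proper_card; apply/properP; split.
  by apply/subsetP => z; rewrite !inE; apply: le_trans; apply: ltW.
by exists x; rewrite inE ?lexx // lt_geF.
Qed.

(** Induction on the down-set of a: a reducible a equals r(a), a join of strictly smaller
    elements. *)
Lemma le_irr a b : (forall e : irr T, irr_val e <= a -> irr_val e <= b) -> a <= b.
Proof.
have [n] := ubnP #|[set z | (z <= a)%O]|; elim: n a => // n ih a; rewrite ltnS => hn h.
have [ia|na] := boolP (irreducible a); first by apply: (h (Irr ia)).
rewrite -(lat_r_id na); apply/joinsP => x hx; apply: ih => [|e he].
  exact: leq_trans (card_down_lt hx) hn.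
by apply: h; apply: le_trans he (ltW hx).
Qed.

Lemma lat_r_rinf t : lat_r (lat_rinf t) = lat_rinf t.
Proof.
apply: (iter_stable (m := fun t => #|[set z | (z <= t)%O]|)) => [y /eqP ne|].
  by apply: card_down_lt; rewrite lt_neqAle ne lat_r_le.
exact: max_card.
Qed.

Lemma rinf_nirr t : ~~ irreducible (lat_rinf t).
Proof. by rewrite lat_r_irr lat_r_rinf ltxx. Qed.

Lemma rinf_le t : lat_rinf t <= t.
Proof. by rewrite /lat_rinf; elim: #|_| => //= n; apply: le_trans (lat_r_le _). Qed.

Lemma rinf_id t : ~~ irreducible t -> lat_rinf t = t.
Proof. by move=> h; rewrite /lat_rinf; elim: #|_| => //= n ->; apply: lat_r_id. Qed.

Lemma rinf_mono x y : x <= y -> lat_rinf x <= lat_rinf y.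
Proof.
rewrite /lat_rinf => h; elim: #|_| => //= n ih; apply/joinsP => z hz.
by apply: le_lat_r; apply: lt_le_trans ih.
Qed.

(** Whatever lies strictly below t lies below r(t), so x follows the descent s, r(s), r^2(s), ...
    until it equals a term, or stays below all of them. *)
Lemma le_rinf_iter x s : x <= s ->
  x <= lat_rinf s \/ exists n, x = iter n (@lat_r _ T) s.
Proof.
rewrite /lat_rinf => h; elim: #|_| => [|n [|]]; [by left| |by right].
rewrite le_eqVlt => /orP[/eqP ->|/le_lat_r]; last by left.
by right; exists n.
Qed.

Lemma rinf_iter n s : lat_rinf (iter n (@lat_r _ T) s) = lat_rinf s.
Proof.
elim: n => //= n <-; rewrite /lat_rinf -iterSr iterS.
exact: lat_r_rinf.
Qed.

Lemma le_rinf_or x s : x <= s -> x <= lat_rinf s \/ lat_rinf x = lat_rinf s.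
Proof. by move/le_rinf_iter => [|[n ->]]; [left|right; apply: rinf_iter]. Qed.

Lemma iter_lat_r_le m n s : (m <= n)%N ->
  iter n (@lat_r _ T) s <= iter m (@lat_r _ T) s.
Proof.
move/subnK <-; elim: (n - m)%N => //= p; exact: le_trans (lat_r_le _).
Qed.

Lemma sigma_ge t : t <= lat_sigma t.
Proof. by apply/meetsP => x /andP[_ /ltW]. Qed.

Lemma sigma_le t f : irreducible f -> t < f -> lat_sigma t <= f.
Proof. by move=> h1 h2; apply: (@meets_inf _ _ _ _ _ id); rewrite h1. Qed.

Lemma sigma_sinf t : lat_sigma (lat_sinf t) = lat_sinf t.
Proof.
apply: (iter_stable (m := fun t => #|[set z | (t <= z)%O]|)) => [y /eqP ne|].
  by apply: card_up_lt; rewrite lt_neqAle eq_sym ne sigma_ge.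
exact: max_card.
Qed.

Lemma iter_sigma_le n m t : (n <= m)%N ->
  iter n (@lat_sigma _ T) t <= iter m (@lat_sigma _ T) t.
Proof.
move/subnK <-; elim: (m - n)%N => //= p ih.
by apply: le_trans ih (sigma_ge _).
Qed.

Lemma sinf_ge t : t <= lat_sinf t.
Proof. exact: (@iter_sigma_le 0). Qed.

Lemma sinf_id t : lat_sigma t = t -> lat_sinf t = t.
Proof. by move=> h; rewrite /lat_sinf; elim: #|_| => //= n ->. Qed.

Lemma sigma_mono x y : x <= y -> lat_sigma x <= lat_sigma y.
Proof.
move=> h; apply/meetsP => f /andP[hf hy]; apply: sigma_le => //.
exact: le_lt_trans h hy.
Qed.

Lemma sinf_mono x y : x <= y -> lat_sinf x <= lat_sinf y.
Proof. by rewrite /lat_sinf => h; elim: #|_| => //= n; apply: sigma_mono. Qed.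

Lemma sinf_iter n t : lat_sinf (iter n (@lat_sigma _ T) t) = lat_sinf t.
Proof.
elim: n => //= n <-; rewrite /lat_sinf -iterSr iterS.
exact: sigma_sinf.
Qed.

Lemma le_lat_b t : ~~ irreducible t -> t <= lat_b t.
Proof. by move=> h; rewrite -{1}(rinf_id h) rinf_mono // sinf_ge. Qed.

(** Since b(t) <= sigma^oo(t), which sigma fixes, a second application cannot go higher; it cannot
    go lower because b(t) is reducible. *)
Lemma lat_b_b t : lat_b (lat_b t) = lat_b t.
Proof.
apply/le_anti/andP; split; last by apply/le_lat_b/rinf_nirr.
apply: rinf_mono; rewrite -[lat_sinf t in X in _ <= X](sinf_id (sigma_sinf t)).
by apply/sinf_mono/rinf_le.
Qed.

(* If sigma c is reducible, the irreducibles above c and above sigma c are    *)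
(* the same, so that sigma c is fixed by sigma.                               *)
Lemma sigma_irr c : lat_sigma c < lat_b c -> irreducible (lat_sigma c).
Proof.
move=> h; apply/negPn/negP => ni; have /negP := negbT (lt_geF h); apply.
apply: le_trans (rinf_le _) _; rewrite -(sinf_iter 1) /= sinf_id //.
apply/le_anti; rewrite sigma_ge andbT; apply/meetsP => f /andP[hf hc].
apply: sigma_le => //; rewrite lt_neqAle sigma_le // andbT.
by apply/eqP => e; rewrite e hf in ni.
Qed.

Lemma lat_b_sigma n t : lat_b (iter n (@lat_sigma _ T) t) = lat_b t.
Proof. by rewrite /lat_b sinf_iter. Qed.

(** If x is not below b(t) = r^oo(sigma^oo(t)), then r^oo(x) = b(t), which puts b(t) below x. *)
Lemma lat_b_lt x t : x <= lat_sinf t -> lat_sinf x = lat_sinf t ->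
  ~~ (lat_b t <= x) -> x < lat_b t.
Proof.
move=> h1 h2 h3; have [h|h] := le_rinf_or h1.
  by rewrite lt_neqAle h andbT; apply: contraNneq h3 => ->.
by move: h3; rewrite /lat_b -h rinf_le.
Qed.

Lemma GcP a : a \in lat_Gc T -> ~~ irreducible a /\ a < lat_b a.
Proof.
rewrite !inE negb_or => /andP[h1 h2]; split=> //.
by rewrite lt_neqAle h2 le_lat_b.
Qed.

Lemma lat_b_in_G a : lat_b a \in lat_G T.
Proof. by rewrite inE lat_b_b eqxx orbT. Qed.

(** Here r + 1 is the least n with b <= sigma^n(a); n = [#|T|] qualifies because b <= sigma^oo(a).
    The earlier terms lie strictly below b by [lat_b_lt], and none is fixed by sigma, since a fixed
    one would equal sigma^oo(a) >= b. *)
Lemma u_fits_ex a : a \in lat_Gc T -> has (u_fits a) (iota 0 #|T|).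
Proof.
move=> /GcP[ia ab]; have ex : exists n, lat_b a <= iter n (@lat_sigma _ T) a.
  by exists #|T|; apply: rinf_le.
case: (ex_minnP ex) => -[|r] hr hmin; first by rewrite (lt_geF ab) in hr.
have lt i : (i <= r)%N -> iter i (@lat_sigma _ T) a < lat_b a.
  move=> hi; apply: lat_b_lt; rewrite ?sinf_iter //.
    by rewrite -[lat_sinf a](sinf_iter i) sinf_ge.
  by apply/negP => /hmin; rewrite ltnNge hi.
apply/hasP; exists r.
  rewrite mem_iota add0n /=; apply: hmin; exact: rinf_le.
rewrite /u_fits lt // hr !andbT; apply/forallP => i.
rewrite lt_neqAle sigma_ge andbT; apply/eqP => /esym e.
have /negP := negbT (lt_geF (lt i (ltnW (ltn_ord i)))); apply.
by apply: le_trans (rinf_le _) _; rewrite -(sinf_iter i) sinf_id.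
Qed.

(** The telescoping uses only these properties of (a_0, ..., a_(r+1)), so it is carried out for any
    sequence that has them. *)
Definition u_chain_spec (c : seq T) : Prop :=
  [/\ sorted <%O c,
      forall i, (i < size c)%N -> irreducible (nth \bot c i) = (0 < i < (size c).-1)%N
    & forall i f, (i.+1 < size c)%N -> irreducible f -> nth \bot c i < f ->
        nth \bot c i.+1 <= f].

Lemma size_u_chain a : size (u_chain a) = (u_rank a).+2.
Proof. by rewrite size_rcons size_traject. Qed.

Lemma nth_u_chain a i : (i <= (u_rank a).+1)%N ->
  nth \bot (u_chain a) i =
  if (i <= u_rank a)%N then iter i (@lat_sigma _ T) a else lat_b a.
Proof.
move=> hi; rewrite nth_rcons size_traject ltnS; case: leqP => h.
  by rewrite (set_nth_default a) ?size_traject ?nth_traject.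
by rewrite eqn_leq hi h.
Qed.

(** Interior terms are irreducible by [sigma_irr]; the ends a and b are not. In the third condition
    the step from sigma^r(a) to b rests on b <= sigma^(r+1)(a). *)
Lemma u_chainP a : a \in lat_Gc T -> u_chain_spec (u_chain a).
Proof.
move=> ha; have [ia ab] := GcP ha.
have := nth_find 0%N (u_fits_ex ha); rewrite -/(u_rank a).
rewrite nth_iota ?add0n; last by rewrite -[X in (_ < X)%N](size_iota 0) -has_find u_fits_ex.
case/and3P => /forallP hs hb hb'.
have lt i : (i <= u_rank a)%N -> iter i (@lat_sigma _ T) a < lat_b a.
  by move=> hi; apply: le_lt_trans (iter_sigma_le _ hi) hb.
split.
- apply/(sortedP \bot) => i; rewrite size_u_chain !ltnS => hi.
  rewrite !nth_u_chain ?(leqW hi) ?hi //; case: ltnP => h.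
    exact: (hs (Ordinal h)).
  by apply: lt.
- move=> i; rewrite size_u_chain ltnS => hi; rewrite nth_u_chain //=.
  rewrite ltnS; case: (leqP i (u_rank a)) => h; last by rewrite andbF; apply/negbTE/rinf_nirr.
  case: i h {hi} => [|i] h; first exact/negbTE.
  by rewrite /=; apply: sigma_irr; rewrite lat_b_sigma; apply: (lt i.+1).
- move=> i f; rewrite size_u_chain !ltnS => hi hf.
  rewrite !nth_u_chain ?(leqW hi) ?hi // => hlt.
  have := sigma_le hf hlt; case: ltnP => // h.
  by apply: le_trans; rewrite (@anti_leq i (u_rank a)) ?hi.
Qed.

End LatticeTheory.

(** * The alternating sum along a chain *)

Section AlternatingSum.
Variables (d : Order.disp_t) (T : finTBLatticeType d).
Implicit Types (y : T) (e : irr T).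
Local Open Scope order_scope.

(** Reading positions in the whole of [c] makes brackets of different lengths comparable. An element
    outside [c] has index [size c], which fails the test. *)
Lemma bracket_takeE (c : seq T) j y : (j < size c)%N ->
  bracket (take j.+1 c) y =
  if (index y c < j)%N then nth \bot c (index y c).+1 else y.
Proof.
move=> hj; rewrite ffunE /=; have st : size (take j.+1 c) = j.+1.
  by rewrite size_take; case: ltnP => // h; apply/eqP; rewrite eqn_leq h.
have [yc|yc] := boolP (y \in take j.+1 c).
  have e : index y (take j.+1 c) = index y c.
    by rewrite -[in RHS](cat_take_drop j.+1 c) index_cat yc.
  rewrite e st ltnS; case: ltnP => // h.
  by rewrite nth_take ?ltnS //; apply: set_nth_default; apply: leq_ltn_trans hj.
have -> : index y (take j.+1 c) = j.+1 by rewrite memNindex.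
rewrite st ltnNge leqnSn /=; case: ltnP => // h; case/negP: yc.
by rewrite in_take ?ltnS 1?ltnW // -index_mem (ltn_trans h).
Qed.

Section Chain.
Variables (c : seq T) (hc : u_chain_spec c).

(** This is [c_0, ..., c_j]. As [brk 0] is the identity, the alternating sum of all [brk j] along
    the chain of a is the identity minus u_a. *)
Definition brk j : {ffun T -> T} := bracket (take j.+1 c).

Lemma u_chain_lt i j : (i < j < size c)%N -> nth \bot c i < nth \bot c j.
Proof.
case: hc => h _ _; case/andP => h1 h2.
by apply: (sorted_ltn_nth (@lt_trans _ T) \bot h); rewrite // inE (ltn_trans h1).
Qed.

Lemma index_u_chain i : (i < size c)%N -> index (nth \bot c i) c = i.
Proof. by move=> h; apply: index_uniq => //; case: hc => /lt_sorted_uniq. Qed.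

Lemma brk_nth_ge j i : (j <= i < size c)%N -> brk j (nth \bot c i) = nth \bot c i.
Proof.
case/andP=> h1 h2; rewrite bracket_takeE ?(leq_ltn_trans h1) //.
by rewrite index_u_chain // ltnNge h1.
Qed.

Lemma brkS j y : (j.+1 < size c)%N ->
  brk j.+1 y = if y == nth \bot c j then nth \bot c j.+1 else brk j y.
Proof.
move=> h; have h' := ltnW h; rewrite !bracket_takeE //.
case: eqP => [->|ne]; first by rewrite index_u_chain // ltnSn.
rewrite ltnS leq_eqVlt; case: eqP => // e; case: ne.
by rewrite -e nth_index // -index_mem e.
Qed.

(** The elements moved by [brk j] land on c_1, ..., c_j, all different from c_(j+1). *)
Lemma brk_eq_next j y : (j.+1 < size c)%N ->
  (brk j y == nth \bot c j.+1) = (y == nth \bot c j.+1).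
Proof.
move=> h; have h' := ltnW h; rewrite bracket_takeE //.
case: ltnP => // hi; rewrite -[in RHS](@nth_index _ \bot y c).
  by rewrite !lt_eqF // u_chain_lt // h andbT ltnS // ltnW.
by rewrite -index_mem (ltn_trans hi).
Qed.

Section Test.
Variables (X : finType) (Y : irr T -> {set X}) (phi : {ffun X -> T}).

Definition fcomp (p : {ffun T -> T}) (psi : {ffun X -> T}) : {ffun X -> T} :=
  [ffun x => p (psi x)].

Lemma fcompE p psi x : fcomp p psi x = p (psi x).
Proof. exact: ffunE. Qed.

Definition hit (e : irr T) (S : {set X}) (psi : {ffun X -> T}) : bool :=
  [forall x in S, psi x <= irr_val e] && [exists x in S, psi x == irr_val e].

Definition hits (Y' : irr T -> {set X}) (psi : {ffun X -> T}) : bool :=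
  [forall e, hit e (Y' e) psi].

Lemma hitP e (S : {set X}) (psi : {ffun X -> T}) : reflect
  ((forall x, x \in S -> psi x <= irr_val e) /\
   (exists2 x, x \in S & psi x = irr_val e)) (hit e S psi).
Proof.
apply: (iffP andP) => -[h1 h2]; split.
- by move=> x hx; apply: (forall_inP h1).
- by have /exists_inP[x hx /eqP h] := h2; exists x.
- exact/forall_inP.
- by case: h2 => x hx h; apply/exists_inP; exists x => //; apply/eqP.
Qed.

Definition attained j : bool :=
  [exists e : irr T, (irr_val e == nth \bot c j) &&
     [exists x in Y e, phi x == nth \bot c j]].

Lemma attainedP j : reflect
  (exists e, irr_val e = nth \bot c j /\ exists2 x, x \in Y e & phi x = nth \bot c j)
  (attained j).
Proof.
apply: (iffP existsP) => -[e].
  case/andP => /eqP h /exists_inP[x hx /eqP hx']; exists e; split=> //.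
  by exists x.
case=> h [x hx hx']; exists e; rewrite h eqxx; apply/exists_inP.
by exists x => //; apply/eqP.
Qed.

(* [attained j] separates the two ways of hitting c_j after c_(j-1) has been  *)
(* moved to c_j: phi itself takes the value c_j, or only c_(j-1). So both     *)
(* sides are the common part of two consecutive terms of the alternating sum. *)
Lemma hits_brkS j : (j.+1 < size c)%N ->
  hits Y (fcomp (brk j.+1) phi) && ((j.+2 == size c) || attained j.+1) =
  hits Y (fcomp (brk j) phi) && ~~ attained j.
Proof.
move=> hj; have [hlt hirr hnext] := hc.
have lt1 : nth \bot c j < nth \bot c j.+1 by apply: u_chain_lt; rewrite ltnSn.
(* An irreducible other than c_j is above c_j exactly when it is above c_(j+1), so moving c_j to
   c_(j+1) does not affect the bound. *)
have F1 (e : irr T) y : irr_val e != nth \bot c j ->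
    (brk j.+1 y <= irr_val e) = (brk j y <= irr_val e).
  move=> ne; rewrite brkS //; case: eqP => // ->; rewrite brk_nth_ge ?leqnn ?(ltnW hj) //.
  apply/idP/idP => [|h]; first by apply: le_trans; apply: ltW.
  by apply: hnext => //; [apply: irrP|rewrite lt_neqAle eq_sym ne].
have F2 (e : irr T) y : irr_val e != nth \bot c j -> irr_val e != nth \bot c j.+1 ->
    (brk j.+1 y = irr_val e) <-> (brk j y = irr_val e).
  move=> n1 n2; rewrite brkS //; case: eqP => // ->.
  rewrite brk_nth_ge ?leqnn ?(ltnW hj) //.
  by split=> h; [rewrite h eqxx in n2|rewrite h eqxx in n1].
have inj e e' i : irr_val e = nth \bot c i -> irr_val e' = nth \bot c i -> e = e'.
  by move=> h h'; apply: val_inj; rewrite /= h h'.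
apply/andP/andP => -[/forallP h1 h2].
  (* A point of [Y e] where phi equals e = c_j would be lifted to c_(j+1), above e. *)
  have na : ~~ attained j.
    apply/attainedP => -[e [he [x hx hx']]]; have /hitP[le _] := h1 e.
    have := le x hx; rewrite fcompE brkS // hx' eqxx he => le'.
    by have := le_lt_trans le' lt1; rewrite ltxx.
  split=> //; apply/forallP => e; have /hitP[le [x hx hx']] := h1 e; apply/hitP.
  have [ej|nj] := eqVneq (irr_val e) (nth \bot c j).
    have npj z : z \in Y e -> phi z == nth \bot c j = false.
      move=> hz; apply/eqP => hz'; case/attainedP: na; exists e; split=> //.
      by exists z.
    split=> [z hz|]; first by have := le z hz; rewrite !fcompE brkS // npj.
    by exists x => //; move: hx'; rewrite !fcompE brkS // npj.
  have le' z : z \in Y e -> fcomp (brk j) phi z <= irr_val e.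
    by move=> hz; rewrite fcompE -F1 //; have := le z hz; rewrite fcompE.
  split=> //; have [ej1|nj1] := eqVneq (irr_val e) (nth \bot c j.+1); last first.
    by exists x => //; rewrite fcompE; apply/F2 => //; rewrite -hx' fcompE.
  (* Being irreducible, c_(j+1) = e is not the end of the chain, so [attained j.+1] must hold. *)
  have nl : (j.+2 == size c) = false.
    apply/eqP => hl; have := irrP e; rewrite ej1 hirr //= -hl /=.
    by rewrite ltnn.
  move: h2; rewrite nl => /attainedP[e' [he' [z hz hz']]].
  have ee := inj _ _ _ he' ej1; rewrite ee in hz.
  by exists z => //; rewrite fcompE hz' brk_nth_ge ?leqnSn.
split; last first.
  have [//|nl] := eqVneq; have irr1 : irreducible (nth \bot c j.+1).
    rewrite hirr //=; move: hj nl; case: (size c) => // n.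
    by rewrite /= eqSS ltnS leq_eqVlt => /orP[->|].
  apply/attainedP; exists (Irr irr1); split=> //.
  have /hitP[_ [x hx]] := h1 (Irr irr1); rewrite fcompE => /eqP.
  by rewrite /= brk_eq_next // => /eqP hx'; exists x.
apply/forallP => e; have /hitP[le [x hx hx']] := h1 e; apply/hitP.
have [ej|nj] := eqVneq (irr_val e) (nth \bot c j).
  have npj z : z \in Y e -> phi z == nth \bot c j = false.
    move=> hz; apply/eqP => hz'; case/attainedP: h2; exists e; split=> //.
    by exists z.
  split=> [z hz|]; first by have := le z hz; rewrite !fcompE brkS // npj.
  by exists x => //; move: hx'; rewrite !fcompE brkS // npj.
split=> [z hz|]; first by rewrite fcompE F1 //; have := le z hz; rewrite fcompE.
have [ej1|nj1] := eqVneq (irr_val e) (nth \bot c j.+1); last first.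
  by exists x => //; rewrite fcompE; apply/F2 => //; rewrite -hx' fcompE.
exists x => //; move: hx' => /eqP; rewrite !fcompE ej1 brk_eq_next // => /eqP ->.
by rewrite brk_nth_ge ?leqnn.
Qed.

Lemma attained_end j : (j < size c)%N -> ~~ (0 < j < (size c).-1)%N -> attained j = false.
Proof.
move=> hj nj; apply/negbTE/negP => /attainedP[e [he _]]; case/negP: nj.
by case: hc => _ h _; rewrite -h // -he irrP.
Qed.

Lemma brk0 : fcomp (brk 0) phi = phi.
Proof.
apply/ffunP => x; rewrite fcompE ffunE /=; case: (c) => [|z s] //=.
by rewrite take0.
Qed.

(** Each term [H j] splits into [K j] and an attained part, and the attained part of the next term
    equals [K j]. So the partial sum up to m is (-1)^m [K m]; at m = 0 nothing is attained because
    c_0 is reducible. *)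
Lemma hits_brk_sum (A : pzRingType) n : size c = n.+2 ->
  (\sum_(j < n.+2) (-1) ^+ j * (hits Y (fcomp (brk j) phi))%:R = 0 :> A)%R.
Proof.
move=> sc; pose H j := hits Y (fcomp (brk j) phi).
pose K j := H j && ~~ attained j.
have HK j : (H j)%:R = (K j)%:R + (H j && attained j)%:R :> A.
  by rewrite /K; case: (H j); case: (attained j); rewrite ?addr0 ?add0r.
suff part m : (m <= n)%N ->
    (\sum_(j < m.+1) (-1) ^+ j * (H j)%:R = (-1) ^+ m * (K m)%:R :> A)%R.
  (* At the last index the alternative [j.+2 == size c] holds, so the whole last term equals [K n]
     and cancels the partial sum. *)
  have step := @hits_brkS n; rewrite sc ltnSn eqxx orTb andbT in step.
  by rewrite big_ord_recr part //= step // exprS mulN1r mulNr subrr.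
elim: m => [_|m ih hm].
  by rewrite big_ord1 HK attained_end ?sc //= andbF addr0.
rewrite big_ord_recr /= ih 1?ltnW // HK.
have := @hits_brkS m; rewrite sc eqSS ltnS ltnW // => /(_ isT).
rewrite eqSS (ltn_eqF hm) orFb -/(H _) -/(H _) -/(K _) => ->.
by rewrite exprS mulN1r !mulNr mulrDr opprD addrCA subrr addr0.
Qed.

End Test.
End Chain.
End AlternatingSum.

(** * Supports in free modules, and composition with u_T *)

Section Support.
Variables (k : fieldType).

Definition supported (I : finType) (P : pred I) (x : kfree k I) : Prop :=
  forall i, x i != 0 -> P i.

Lemma kext_supported (I J : finType) (f : I -> kfree k J) (P : pred J) (x : kfree k I) :
  (forall i, x i != 0 -> supported P (f i)) -> supported P (kext f x).
Proof.
move=> h j; rewrite /kext sum_ffunE => hj.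
have [i hi] : exists i, (x i *: f i) j != 0.
  apply/existsP; apply: contraNT hj => /existsPn hj.
  by apply/eqP/big1 => i _; apply/eqP/negPn/hj.
rewrite ffunE in hi; have xi : x i != 0.
  by apply: contraNneq hi => ->; rewrite scale0r.
by apply: (h i xi); apply: contraNneq hi => ->; rewrite scaler0.
Qed.

Lemma kbase_supported (I : finType) (P : pred I) i :
  P i -> supported P (kbase i : kfree k I).
Proof.
by move=> hi j; rewrite ffunE; have [->|_] := eqVneq j i; rewrite ?eqxx.
Qed.

Lemma supported_eq0 (I : finType) (P : pred I) (x : kfree k I) i :
  supported P x -> ~~ P i -> x i = 0.
Proof. by move=> h; apply: contraNeq => /h. Qed.

End Support.

Section UT.
Variables (k : fieldType) (d : Order.disp_t) (T : finTBLatticeType d) (X : finType).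
Implicit Types (a : T) (phi : {ffun X -> T}) (Y : irr T -> {set X}).

Local Notation kmapT := (kmap k T T).
Local Notation kmapX := (kmap k T X).

Definition hits_sum Y : kmapX -> k^o :=
  kext (fun phi => ((hits Y phi)%:R : k) : k^o).

HB.instance Definition _ Y := GRing.Linear.on (hits_sum Y).

Lemma kmap_compE p phi :
  kmap_comp (kbase p) (kbase phi) = kbase (fcomp p phi) :> kmapX.
Proof. exact: kbilE. Qed.

Lemma kmap_comp_suml (I : Type) (r : seq I) (c : I -> k) (u : I -> kmapT) (x : kmapX) :
  kmap_comp (\sum_(i <- r) c i *: u i) x = \sum_(i <- r) c i *: kmap_comp (u i) x.
Proof.
elim: r => [|i r ih]; first by rewrite !big_nil [LHS]kbil0l.
by rewrite !big_cons -ih [LHS]kbilDl; congr (_ + _); rewrite [LHS]kbilZl.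
Qed.

Lemma kmap_comp_sumr (u : kmapT) (x : kmapX) :
  kmap_comp u x = \sum_phi x phi *: kmap_comp u (kbase phi).
Proof.
rewrite {1}(kfree_sum x) /kext; elim: (index_enum _) => [|i r ih].
  by rewrite !big_nil [LHS]kbil0r.
by rewrite !big_cons -ih [LHS]kbilDr; congr (_ + _); rewrite [LHS]kbilZr.
Qed.

Lemma kmap_compA (u v : kmapT) (x : kmapX) :
  kmap_comp (kmap_comp u v) x = kmap_comp u (kmap_comp v x).
Proof.
apply: kbilA => p q phi; rewrite !kbilE; congr kbase.
by apply/ffunP => i; rewrite !ffunE.
Qed.

Lemma kmap_comp1 (x : kmapX) : kmap_comp (kbase [ffun y => y]) x = x.
Proof.
rewrite kmap_comp_sumr [RHS]kfree_sum; apply: eq_bigr => phi _.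
by rewrite kmap_compE; congr (_ *: kbase _); apply/ffunP => i; rewrite !ffunE.
Qed.

(** In the vanishing alternating sum, the term of index 0 is phi and the others are the terms of u_a
    phi with opposite sign. *)
Lemma hits_u_elt a Y (x : kmapX) : a \in lat_Gc T ->
  hits_sum Y (kmap_comp (u_elt k a) x) = hits_sum Y x.
Proof.
move=> ha; rewrite kmap_comp_sumr [in RHS](kfree_sum x) /kext !linear_sum.
apply: eq_bigr => phi _; rewrite !linearZ /=; congr (_ *: _).
rewrite /u_elt kmap_comp_suml linear_sum [RHS]kextE.
have := hits_brk_sum (u_chainP ha) Y phi k (size_u_chain a).
rewrite big_ord_recl expr0 mul1r brk0 => /eqP; rewrite addr_eq0 => /eqP ->.
rewrite -sumrN; apply: eq_bigr => j _; rewrite linearZ /= kmap_compE.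
by rewrite /hits_sum kextE exprS mulN1r mulNr opprK.
Qed.

Lemma hits_u_comp (s : seq T) Y (x : kmapX) : {subset s <= lat_Gc T} ->
  hits_sum Y (kmap_comp (u_comp k s) x) = hits_sum Y x.
Proof.
elim: s x => [|a s ih] x hs /=; first by rewrite kmap_comp1.
rewrite kmap_compA hits_u_elt ?ih // => [b hb|]; apply: hs; rewrite inE ?eqxx //.
by rewrite hb orbT.
Qed.

(** A map hit by [Y] takes every irreducible as a value, so the maps killed by pi contribute 0. *)
Lemma hits_pi Y (x : kmapX) : hits_sum Y (lat_pi x) = hits_sum Y x.
Proof.
rewrite /lat_pi [in RHS](kfree_sum x) {1}/kext !linear_sum.
apply: eq_bigr => phi _; rewrite !linearZ /=; congr (_ *: _).
case: ifP => // /negP nc; rewrite linear0 [RHS]kextE.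
suff -> : hits Y phi = false by [].
apply/negbTE/negP => /forallP h; case: nc; apply/forallP => e.
by have /hitP[_ [i _ <-]] := h e; apply: codom_f.
Qed.

(** Each bracket of u_a moves a = c_0 and sends nothing to it, and the elements c_1, ..., c_(r+1)
    onto which it moves others lie in G. The second fact keeps a value removed by one factor from
    being created again by another, in whatever order the factors come. *)
Lemma u_elt_supported a : a \in lat_Gc T ->
  supported (fun p : {ffun T -> T} => [forall y, (p y != a) &&
    ((p y \in lat_Gc T) ==> (p y == y))]) (u_elt k a).
Proof.
move=> ha p; rewrite /u_elt sum_ffunE => hp.
have [j hj] : exists j : 'I_(u_rank a).+1, p = brk (u_chain a) j.+1.
  have [/existsP[j /eqP ->]|/existsPn nj] :=
    boolP [exists j : 'I_(u_rank a).+1, p == brk (u_chain a) j.+1]; first by exists j.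
  case/eqP: hp; apply: big1 => j _; rewrite !ffunE -/(brk (u_chain a) j.+1).
  by rewrite (negbTE (nj j)) scaler0.
rewrite hj; apply/forallP => y; have [_ _ hnext] := u_chainP ha.
have sj : (j.+1 < size (u_chain a))%N by rewrite size_u_chain ltnS ltn_ord.
rewrite bracket_takeE //; have [[nia ab] hc] := (GcP ha, u_chainP ha).
have cG i : (0 < i < size (u_chain a))%N -> nth \bot%O (u_chain a) i \in lat_G T.
  case/andP => i0 hi; have [_ hirr _] := hc.
  have [lst|nl] := eqVneq i (u_rank a).+1.
    by rewrite lst nth_u_chain // ltnn lat_b_in_G.
  by rewrite inE hirr // i0 size_u_chain ltn_neqAle nl -ltnS -size_u_chain hi.
have c0 : nth \bot%O (u_chain a) 0 = a by rewrite nth_u_chain.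
case: ltnP => hy.
  have G1 := @cG (index y (u_chain a)).+1; rewrite ltnS in sj.
  rewrite /= (leq_ltn_trans hy) // in G1; have {}G1 := G1 isT.
  rewrite [_ \in lat_Gc T]inE G1 andbT.
  by apply: contraTneq ha => <-; rewrite inE G1.
rewrite eqxx implybT andbT; apply: contraTneq hy => ->.
by have := index_u_chain hc (ltn_trans (ltn0Sn _) sj); rewrite c0 => ->.
Qed.

Lemma u_comp_supported (s : seq T) phi : {subset s <= lat_Gc T} ->
  supported (fun psi : {ffun X -> T} => [forall i, psi i \notin s])
    (kmap_comp (u_comp k s) (kbase phi)).
Proof.
elim: s => [|a s ih] hs /=.
  by rewrite kmap_comp1; apply: kbase_supported; apply/forallP.
have ha : a \in lat_Gc T by apply: hs; rewrite inE eqxx.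
have hs' : {subset s <= lat_Gc T} by move=> b hb; apply: hs; rewrite inE hb orbT.
rewrite kmap_compA; apply: kext_supported => p /(u_elt_supported ha)/forallP hp.
apply: kext_supported => psi /(ih hs')/forallP hpsi.
apply: kbase_supported; apply/forallP => i; rewrite ffunE inE negb_or.
have /andP[-> /implyP hG] := hp (psi i); apply/negP => his.
by have := hpsi i; rewrite -(eqP (hG (hs' _ his))) his.
Qed.

Lemma kB_inclP (x : kmapX) :
  supported (fun phi : {ffun X -> T} => covers_irr phi && [forall i, phi i \in lat_G T]) x ->
  exists y, kB_incl y = x.
Proof.
move=> hx; exists ([ffun phi => x (Bmap_val phi)] : kB k T X).
apply/ffunP => psi; rewrite /kB_incl /kext sum_ffunE.
have [hpsi|hpsi] := boolP (covers_irr psi && [forall i, psi i \in lat_G T]).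
  rewrite (bigD1 (BMap hpsi)) //= big1 => [|phi ne].
    by rewrite addr0 !ffunE eqxx [_ *: _]mulr1.
  rewrite !ffunE; case: eqP => [e|_]; last by rewrite [_ *: _]mulr0.
  by case/eqP: ne; apply: val_inj.
rewrite (supported_eq0 hx hpsi); apply: big1 => phi _; rewrite !ffunE.
case: eqP => [e|_]; last by rewrite [_ *: _]mulr0.
by case/negP: hpsi; rewrite e BmapP.
Qed.

Lemma pi_u_comp_in_kB (s : seq T) phi : perm_eq s (enum (lat_Gc T)) ->
  exists y, kB_incl y = lat_pi (kmap_comp (u_comp k s) (kbase phi)).
Proof.
move=> hs; apply: kB_inclP; have memE i : (i \in s) = (i \in lat_Gc T).
  by rewrite (perm_mem hs) mem_enum.
have sub : {subset s <= lat_Gc T} by move=> i; rewrite memE.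
apply: kext_supported => psi /(u_comp_supported sub)/forallP hpsi.
case: ifP => [hc|_]; last by move=> j; rewrite ffunE eqxx.
apply: kbase_supported; rewrite hc; apply/forallP => i.
by have := hpsi i; rewrite memE inE negbK.
Qed.

End UT.

(** * Independence *)

Section Separation.
Variables (Z : zmodType) (X I : finType) (pre : I -> {set X}) (mu : I -> Z).

(** Subtracting the equation for the complement of S from the one for X leaves the sum over [pre i]
    contained in S. Induction on the size of A then isolates [pre i = A]. *)
Lemma sum_preimage_eq0 :
  (forall i, mu i != 0 -> pre i != set0) ->
  (forall S : {set X}, \sum_i mu i *+ (pre i :&: S != set0) = 0) ->
  forall A, \sum_(i | pre i == A) mu i = 0.
Proof.
move=> hpre h; have mu0 i : pre i = set0 -> mu i = 0.
  by move=> e; apply/eqP/negPn/negP => /hpre; rewrite e eqxx.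
have sub0 (S : {set X}) : \sum_(i | pre i \subset S) mu i = 0.
  have := h setT; rewrite (bigID (fun i => pre i \subset S)) /=.
  have <- : \sum_i mu i *+ (pre i :&: ~: S != set0) =
      \sum_(i | ~~ (pre i \subset S)) mu i *+ (pre i :&: setT != set0).
    rewrite [RHS]big_mkcond; apply: eq_bigr => i _; rewrite setI_eq0 -subsets_disjoint.
    case: (boolP (pre i \subset S)) => //= hS; rewrite setIT.
    by case: eqP => // /mu0 ->; rewrite mul0rn.
  rewrite h addr0 => e0; rewrite -[RHS]e0; apply: eq_bigr => i _; rewrite setIT.
  by case: eqP => // /mu0 ->; rewrite mul0rn.
move=> A; have [n] := ubnP #|A|; elim: n A => // n ih A; rewrite ltnS => hn.
have := sub0 A; rewrite (bigID (fun i => pre i == A)) /=.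
rewrite (eq_bigl (fun i => pre i == A)) => [|i]; last first.
  by case: eqP => [->|]; rewrite ?subxx ?andbF.
suff -> : \sum_(i | (pre i \subset A) && (pre i != A)) mu i = 0 by rewrite addr0.
rewrite (partition_big pre (fun S : {set X} => S \proper A)) => [|i] /=; last first.
  by rewrite properEneq andbC.
apply: big1 => S hS; rewrite -[RHS](ih S); last first.
  exact: leq_trans (proper_card hS) hn.
apply: eq_bigl => i; case: (pre i =P S) => [->|]; rewrite ?andbF // andbT.
by rewrite andbC -properEneq hS.
Qed.

End Separation.

Section Independence.
Variables (d : Order.disp_t) (T : finTBLatticeType d).
Implicit Types (g h a : T) (e f : irr T).
Local Open Scope order_scope.

(* bot g is the bottom a of the chain a < sigma a < ... < sigma^oo a that     *)
(* contains g, and g itself when g is an irreducible outside these chains.    *)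
Definition bot g : T :=
  if [&& irreducible g, lat_rinf g == lat_b (lat_rinf g) & g <= lat_sinf (lat_rinf g)]
  then lat_rinf g else g.

Lemma bot_le g : bot g <= g.
Proof. by rewrite /bot; case: ifP => // _; apply: rinf_le. Qed.

Lemma bot_nirr g : ~~ irreducible g -> bot g = g.
Proof. by rewrite /bot => /negbTE ->. Qed.

Lemma bot_irr g : irreducible (bot g) -> bot g = g.
Proof. by rewrite /bot; case: ifP => // _; rewrite (negbTE (rinf_nirr g)). Qed.

Lemma bot_lat_b g : g \in lat_G T -> ~~ irreducible (bot g) -> lat_b (bot g) = bot g.
Proof.
rewrite /bot inE; case: ifP => [/and3P[_ /eqP <- _]|_] // /orP[->|/eqP <-] //.
Qed.

Lemma bot_sinf g : ~~ irreducible (bot g) -> g <= lat_sinf (bot g).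
Proof. by rewrite /bot; case: ifP => [/and3P[]|] // _ _; apply: sinf_ge. Qed.

(** Either h <= b(a) = a, or r^oo(h) = b(a) = a and h belongs to the chain with bottom a. *)
Lemma bot_le_sinf a h : ~~ irreducible a -> lat_b a = a -> h <= lat_sinf a -> bot h <= a.
Proof.
move=> na ba /[dup] hs /le_rinf_or[|]; rewrite -/(lat_b a) ba => ha.
  exact: le_trans (bot_le h) ha.
have [ih|nh] := boolP (irreducible h); first by rewrite /bot ih ha ba eqxx hs lexx.
by rewrite (bot_nirr nh) -ha rinf_id.
Qed.

(** By [le_rinf_iter] an element with bottom a is a itself or an iterate of r at sigma^oo(a), and
    these iterates decrease. *)
Lemma bot_total g h : g \in lat_G T -> bot g = bot h -> ~~ irreducible (bot g) ->
  g <= h \/ h <= g.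
Proof.
move=> gG e n; have ba := bot_lat_b gG n.
have cases x : bot x = bot g ->
    x = bot g \/ exists m, x = iter m (@lat_r _ T) (lat_sinf (bot g)).
  move=> ex; have : x <= lat_sinf (bot g) by rewrite -ex bot_sinf ?ex.
  case/le_rinf_iter => [|]; last by right.
  rewrite -/(lat_b _) ba => hx; left; apply/le_anti.
  by rewrite hx -ex bot_le.
have [->|[m hm]] := cases g erefl; first by rewrite e; left; apply: bot_le.
have [->|[p hp]] := cases h (esym e); first by right; apply: bot_le.
have [le|/ltnW le] := leqP m p; [right|left].
  by rewrite [leLHS]hp [leRHS]hm iter_lat_r_le.
by rewrite [leLHS]hm [leRHS]hp iter_lat_r_le.
Qed.

Variables (X : finType).
Implicit Types (phi psi : {ffun X -> T}) (Y : irr T -> {set X}) (D : {set irr T}).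

Definition in_B phi : bool := covers_irr phi && [forall x, phi x \in lat_G T].

Lemma in_B_cover phi e : in_B phi -> exists x, phi x = irr_val e.
Proof. by case/andP=> /forallP/(_ e)/codomP[x ->] _; exists x. Qed.

Lemma in_B_G phi x : in_B phi -> phi x \in lat_G T.
Proof. by case/andP=> _ /forallP. Qed.

Definition fiber psi e : {set X} := [set x | psi x == irr_val e].

Section Layer.
Variables (phi : {ffun X -> T}) (hphi : in_B phi).

Definition same_bot psi : bool := [forall x, bot (psi x) == bot (phi x)].

Lemma same_botP psi : reflect (forall x, bot (psi x) = bot (phi x)) (same_bot psi).
Proof. by apply: (iffP forallP) => h x; apply/eqP. Qed.

(* If psi x <= e whenever x is in zone e, then bot (psi x) <= bot (phi x).    *)
Definition zone e : {set X} := [set x |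
  if irreducible (bot (phi x)) then bot (phi x) == irr_val e
  else lat_sinf (bot (phi x)) < irr_val e].

Definition test Y e : {set X} := Y e :|: zone e.

(** When a = bot (phi x) is reducible, psi x is below every irreducible strictly above sigma^oo(a),
    hence below sigma(sigma^oo(a)) = sigma^oo(a), and [bot_le_sinf] applies. *)
Lemma zone_bot psi Y x : hits (test Y) psi -> bot (psi x) <= bot (phi x).
Proof.
move=> /forallP h; have le e : x \in zone e -> psi x <= irr_val e.
  by have /hitP[le _] := h e; move=> hx; apply: le; rewrite inE hx orbT.
have [ib|nb] := boolP (irreducible (bot (phi x))).
  apply: le_trans (bot_le _) _; apply: (le (Irr ib)); by rewrite inE ib /=.
apply: bot_le_sinf => //; first by apply: bot_lat_b => //; apply: in_B_G.
rewrite -sigma_sinf; apply/meetsP => f /andP[hf lf].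
by apply: (le (Irr hf)); rewrite inE (negbTE nb).
Qed.

(** Conversely, maps with the same bottoms as phi satisfy the bounds imposed by the zones, so adding
    zones to a test costs nothing on them. *)
Lemma zone_le psi e x : same_bot psi -> x \in zone e -> psi x <= irr_val e.
Proof.
move=> /same_botP h; rewrite inE -h; case: ifP => [ib /eqP <-|/negbT nb lt].
  by rewrite {1}(bot_irr ib).
exact: le_trans (bot_sinf nb) (ltW lt).
Qed.

Definition agree D psi : bool := [forall e in D, fiber psi e == fiber phi e].

Lemma agreeP D psi : reflect (forall e, e \in D -> fiber psi e = fiber phi e) (agree D psi).
Proof. by apply: (iffP forall_inP) => h e he; apply/eqP; apply: h. Qed.

Definition set_test Y e (S : {set X}) : irr T -> {set X} := fun f => if f == e then S else Y f.

Definition up_closed D : Prop := forall e f, e \in D -> irr_val e <= irr_val f -> f \in D.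

Definition hits_out D Y psi : bool := [forall (f | f \notin D), hit f (test Y f) psi].

Lemma hits_out_D1 D Y e S psi : e \in D ->
  hits_out (D :\ e) (set_test Y e S) psi = hit e (S :|: zone e) psi && hits_out D Y psi.
Proof.
move=> he; apply/forall_inP/andP => [h|[h1 /forall_inP h2] f].
  split; first by have := h e; rewrite /test /set_test eqxx; apply; rewrite !inE eqxx.
  apply/forall_inP => f hf; have := h f; rewrite /test /set_test.
  have [ef|nf] := eqVneq f e; first by rewrite ef he in hf.
  by apply; rewrite !inE negb_and hf orbT.
rewrite /test /set_test !inE negb_and negbK; case: eqP => [->|] //= _.
exact: h2.
Qed.

Lemma agree_D1 D e psi : e \in D ->
  agree D psi = agree (D :\ e) psi && (fiber psi e == fiber phi e).
Proof.
move=> he; apply/agreeP/andP => [h|[/agreeP h /eqP h' f hf]].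
  by split; [apply/agreeP => f; rewrite inE => /andP[_]|apply/eqP]; apply: h.
by have [->//|nf] := eqVneq f e; apply: h; rewrite !inE nf.
Qed.

(** If e is its own bottom, [zone e] contains the whole fiber of psi over e, so the zone alone is
    hit. *)
Lemma hit_zone e psi : in_B psi -> same_bot psi -> irreducible (bot (irr_val e)) ->
  hit e (set0 :|: zone e) psi.
Proof.
move=> hB hs ib; rewrite set0U; apply/hitP; split=> [x|]; first exact: zone_le.
have [x hx] := in_B_cover e hB; exists x => //.
by rewrite inE -(same_botP _ hs) hx ib bot_irr.
Qed.

Lemma fiber_irr_bot e psi : same_bot psi -> irreducible (bot (irr_val e)) ->
  fiber psi e = [set x | bot (phi x) == irr_val e].
Proof.
move=> /same_botP hs ib; apply/setP => x; rewrite !inE -hs.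
apply/eqP/eqP => [->|h]; first exact: bot_irr.
by rewrite -h bot_irr // h irrP.
Qed.

(** The test set keeps the points of S in the layer of e, apart from those where phi exceeds e.
    There psi is comparable with e by [bot_total], and a value above e would be irreducible, hence
    shared with phi. So the bound is automatic and only the meeting with the fiber is tested; the
    zone contains no point of that fiber. *)
Lemma hit_peel D e psi (S : {set X}) : up_closed D -> e \in D ->
  in_B psi -> same_bot psi -> agree (D :\ e) psi -> ~~ irreducible (bot (irr_val e)) ->
  hit e ([set x in S | (bot (phi x) == bot (irr_val e)) && ~~ (irr_val e < phi x)] :|: zone e)
    psi = (fiber psi e :&: S != set0).
Proof.
move=> hD he hB /[dup] hs /same_botP hb /agreeP hag nb.
(* A reducible element of the layer is the bottom, which is below e. *)
have above g : bot g = bot (irr_val e) -> irr_val e < g -> irreducible g.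
  move=> eg lt; apply/negPn/negP => ng; move: lt; rewrite -(bot_nirr ng) eg.
  by rewrite le_gtF // bot_le.
have inD f : irr_val e < irr_val f -> f \in D :\ e.
  move=> lt; rewrite !inE (hD e f) // ?ltW // andbT.
  by apply: contraTneq lt => ->; rewrite ltxx.
apply/hitP/set0Pn => [[_ [x]]|[x]].
  rewrite in_setU => /orP[hx|hx] ex.
    by move: hx; rewrite inE => /andP[xS _]; exists x; rewrite !inE ex eqxx.
  move: hx; rewrite inE -hb ex (negbTE nb) => lt.
  by have := le_lt_trans (bot_sinf nb) lt; rewrite ltxx.
rewrite !inE => /andP[/eqP ex xS]; split=> [z|]; last first.
  exists x => //; rewrite !inE xS -hb ex eqxx /=; apply/orP; left.
  apply/negP => lt; have ip : irreducible (phi x).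
    by apply: above lt => //; rewrite -hb ex.
  have /setP/(_ x) := hag (Irr ip) (inD (Irr ip) lt).
  by rewrite !inE /= eqxx ex lt_eqF.
rewrite in_setU => /orP[|]; last exact: zone_le.
rewrite inE => /andP[_ /andP[/eqP bz nz]].
have bzn : ~~ irreducible (bot (psi z)) by rewrite hb bz.
have [|//|] := bot_total (in_B_G z hB) _ bzn (h := irr_val e); first by rewrite hb.
rewrite le_eqVlt => /orP[/eqP -> //|lt].
have ip : irreducible (psi z) by apply: above lt => //; rewrite hb bz.
have /setP/(_ z) := hag (Irr ip) (inD (Irr ip) lt).
by rewrite !inE /= eqxx => /esym/eqP e'; rewrite e' lt in nz.
Qed.

Variables (Z : zmodType) (lam : {ffun X -> T} -> Z).
Hypothesis lamB : forall psi, lam psi != 0%R -> in_B psi.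
Hypothesis lam_bot : forall psi, lam psi != 0%R ->
  (forall x, bot (psi x) <= bot (phi x)) -> same_bot psi.
Hypothesis lam_sum : forall Y, (\sum_psi lam psi *+ hits Y psi = 0)%R.

(* When e is minimal in D, the choice of Y e only tests which subsets of X    *)
(* meet the fiber over e, and [sum_preimage_eq0] isolates a single fiber.     *)
Lemma layer_sum D Y : up_closed D ->
  (\sum_(psi | same_bot psi && agree D psi) lam psi *+ hits_out D Y psi = 0)%R.
Proof.
have [n] := ubnP #|D|; elim: n D Y => // n ih D Y; rewrite ltnS => hn hD.
(* For D empty, a map hit by [test Y] has bottoms below those of phi, hence equal to them by
   [lam_bot] if its coefficient is nonzero. *)
have [D0|[e0 he0]] := set_0Vmem D.
  rewrite -[RHS](lam_sum (test Y)) [LHS]big_mkcond; apply: eq_bigr => psi _.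
  have -> : hits_out D Y psi = hits (test Y) psi.
    rewrite D0; apply/forallP/forallP => h f; last by apply/implyP.
    by have /implyP := h f; apply; rewrite inE.
  have -> : agree D psi by apply/agreeP => e; rewrite D0 inE.
  rewrite andbT; case: ifP => // /negbT ns.
  have [->|nz] := eqVneq (lam psi) 0%R; first by rewrite mul0rn.
  case: (boolP (hits _ _)) => // hh; case/negP: ns; apply: lam_bot => // x.
  exact: zone_bot hh.
have [e he emin] : exists2 e, e \in D & forall f, f \in D -> ~~ (irr_val f < irr_val e).
  case: (arg_minnP (fun e => #|[set z | (z <= irr_val e)%O]|) he0) => e he hm.
  by exists e => // f /hm; apply: contraL => /card_down_lt; rewrite ltnNge.
have hD' : up_closed (D :\ e).
  move=> f g; rewrite !inE => /andP[nf fD] fg; rewrite (hD f) // andbT.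
  apply: contraNneq nf => ge; rewrite ge in fg; move: (emin f fD).
  by rewrite lt_neqAle fg andbT negbK.
have hn' : (#|D :\ e| < n)%N by rewrite (leq_trans _ hn) // [in X in (_ < X)%N](cardsD1 e) he.
have lam_ext (P : pred {ffun X -> T}) (b b' : {ffun X -> T} -> bool) :
    (forall psi, P psi -> in_B psi -> b psi = b' psi) ->
    (\sum_(psi | P psi) lam psi *+ b psi = \sum_(psi | P psi) lam psi *+ b' psi)%R.
  move=> hbb; apply: eq_bigr => psi hP.
  have [->|/lamB hl] := eqVneq (lam psi) 0%R; first by rewrite !mul0rn.
  by rewrite hbb.
(* If e is its own bottom, the bottom map already determines the fiber over e, and the zone alone
   serves as test. *)
have [ib|nb] := boolP (irreducible (bot (irr_val e))).
  rewrite -[RHS](ih (D :\ e) (set_test Y e set0)) //.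
  rewrite [LHS](eq_bigl (fun psi => same_bot psi && agree (D :\ e) psi)); last first.
    move=> psi /=; case hs: (same_bot psi) => //=; rewrite (agree_D1 _ he).
    rewrite !fiber_irr_bot ?eqxx ?andbT //; exact/same_botP.
  apply: lam_ext => psi /andP[hs _] hB.
  by rewrite (hits_out_D1 _ _ _ he) hit_zone.
pose mu psi := (if same_bot psi && agree (D :\ e) psi
  then lam psi *+ hits_out D Y psi else 0)%R.
rewrite -[RHS](@sum_preimage_eq0 _ _ _ (fiber ^~ e) mu _ _ (fiber phi e)).
- rewrite [LHS]big_mkcond [RHS]big_mkcond; apply: eq_bigr => psi _.
  by rewrite (agree_D1 _ he) andbA /mu; case: eqP => _; rewrite ?andbT ?andbF.
- move=> psi; rewrite /mu; case: ifP => _; last by rewrite eqxx.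
  have [->|/lamB hB _] := eqVneq (lam psi) 0%R; first by rewrite mul0rn eqxx.
  by have [x hx] := in_B_cover e hB; apply/set0Pn; exists x; rewrite inE hx.
- move=> S; rewrite -[RHS](ih (D :\ e) (set_test Y e
    [set x in S | (bot (phi x) == bot (irr_val e)) && ~~ (irr_val e < phi x)])) //.
  rewrite [RHS]big_mkcond; apply: eq_bigr => psi _; rewrite /mu.
  case: ifP => [/andP[hs hag]|_]; last by rewrite mul0rn.
  have [->|/lamB hB] := eqVneq (lam psi) 0%R; first by rewrite !mul0rn.
  by rewrite (hits_out_D1 _ _ _ he) (hit_peel _ hD he) // -mulrnA mulnb andbC.
Qed.

Lemma layer_eq0 : lam phi = 0%R.
Proof.
have := @layer_sum setT (fun=> set0) (fun _ _ _ _ => in_setT _).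
(* With D everything no test remains, and phi alone survives: fibers over irreducibles agree, and a
   reducible value is its own bottom. *)
rewrite (big_pred1 phi) => [|psi].
  suff -> : hits_out setT (fun=> set0) phi by [].
  by apply/forall_inP => f; rewrite inE.
apply/andP/eqP => [[/same_botP hs /agreeP hag]|->]; last first.
  by split; [apply/same_botP|apply/agreeP].
apply/ffunP => x; have [ip|np] := boolP (irreducible (psi x)).
  have /setP/(_ x) := hag (Irr ip) (in_setT _).
  by rewrite !inE /= eqxx => /esym/eqP.
have [iq|nq] := boolP (irreducible (phi x)).
  have /setP/(_ x) := hag (Irr iq) (in_setT _).
  by rewrite !inE /= eqxx => /eqP.
by rewrite -(bot_nirr np) hs bot_nirr.
Qed.

End Layer.

(** Induction on the total size [rk] of the down-sets of the bottoms: a map with smaller bottoms has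
    coefficient 0 by induction, which is the minimality [lam_bot]. *)
Lemma hits_independent (Z : zmodType) (lam : {ffun X -> T} -> Z) :
  (forall psi, lam psi != 0%R -> in_B psi) ->
  (forall Y, (\sum_psi lam psi *+ hits Y psi = 0)%R) ->
  forall psi, lam psi = 0%R.
Proof.
move=> lamB lam_sum psi.
pose rk (psi : {ffun X -> T}) := (\sum_x #|[set z | (z <= bot (psi x))%O]|)%N.
have [n] := ubnP (rk psi); elim: n psi => // n ih phi; rewrite ltnS => hn.
apply/eqP/negPn/negP => nz; case/eqP: (nz).
apply: (@layer_eq0 phi (lamB _ nz)) => // psi nzpsi le.
apply/same_botP => x; apply/eqP/negPn/negP => ne.
suff /ih psi0 : (rk psi < n)%N by rewrite psi0 eqxx in nzpsi.
apply: leq_trans hn; rewrite /rk (bigD1 x) //= [X in (_ < X)%N](bigD1 x) //=.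
rewrite -addSn leq_add //; first by apply: card_down_lt; rewrite lt_neqAle ne le.
apply: leq_sum => y _; apply: subset_leq_card; apply/subsetP => z.
by rewrite !inE => /le_trans; apply.
Qed.

End Independence.

(** * The functors S *)

Section LinearInverse.
Variables (k : fieldType) (U V : lmodType k) (F : {linear U -> V}).

Lemma linear_bij_inverse : injective F -> (forall w, exists u, F u = w) ->
  exists G : {linear V -> U}, cancel F G /\ cancel G F.
Proof.
move=> inj surj; pose g w := sval (cid (surj w)).
have gK : cancel g F by move=> w; apply: (svalP (cid (surj w))).
have g_lin : linear g by move=> a v w; apply: inj; rewrite linearP !gK.
pose G : {linear V -> U} := HB.pack_for {linear V -> U} g
  (GRing.isLinear.Build k V U *:%R g g_lin).
by exists G; split=> // u; apply: inj; apply: gK.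
Qed.

End LinearInverse.

Section TensorZero.
Variables (A B : nzRingType) (M : bimod A B) (N : lmodType B).

Lemma tpure0l (n : N) : (0 : M) \ox n = 0.
Proof. by rewrite -(scale0r (0 : M)) tpureZ scale0r. Qed.

Lemma tpure0r (m : M) : m \ox (0 : N) = 0.
Proof. by apply: (addrI (m \ox 0)); rewrite -tpureDr !addr0. Qed.

End TensorZero.

Section Evaluation.
Variables (k : fieldType) (E : finType) (W : lmodType (kCalg k E)) (X : finType).
Variable rho : kC k E X.

Definition Lev : Lfun W X -> W :=
  tlift (fun (phi : kC_bimod k X E) w => (kcomp rho phi : kCalg k E) *: w).

Lemma Lev_bal :
  balanced (fun (phi : kC_bimod k X E) (w : W) => (kcomp rho phi : kCalg k E) *: w).
Proof.
split=> [phi psi w|phi w w'|phi a w]; first by rewrite /kcomp kbilDr scalerDl.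
  by rewrite scalerDr.
by rewrite scalerA /= /kC_ract -kcompA.
Qed.

Definition Sev : Sfun W X -> W := llift Lev.

(** [Jfun] requires vanishing under every left composition, in particular under [rho]. *)
Lemma Lev_const (t u : Lfun W X) : t - u \in @Jfun k E W X -> Lev t = Lev u.
Proof.
move=> h; apply/eqP; rewrite -subr_eq0 -(tliftB Lev_bal); apply/eqP.
have /asboolP[s [-> hs]] := h.
rewrite -[RHS](hs rho) (tlift_sum Lev_bal); apply: eq_bigr => p _.
exact: (tliftE Lev_bal).
Qed.

Lemma SevE phi w : Sev (Sclass phi w) = (kcomp rho phi : kCalg k E) *: w.
Proof. by rewrite /Sev /Sclass lliftE; [exact: (tliftE Lev_bal)|exact: Lev_const]. Qed.

Lemma SevB : {morph Sev : s t / s - t}.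
Proof.
elim/lquotW => s; elim/lquotW => t; rewrite -linearB /Sev !lliftE; try exact: Lev_const.
exact: (tliftB Lev_bal).
Qed.

End Evaluation.

Section SFunctor.
Variables (k : fieldType) (E : finType) (W : lmodType (kCalg k E)) (X : finType).

Lemma SclassDl (phi psi : kC_bimod k X E) (w : W) :
  Sclass (phi + psi) w = Sclass phi w + Sclass psi w.
Proof. by rewrite /Sclass tpureDl lprojD. Qed.

Lemma SclassDr (phi : kC_bimod k X E) (v w : W) :
  Sclass phi (v + w) = Sclass phi v + Sclass phi w.
Proof. by rewrite /Sclass tpureDr lprojD. Qed.

Lemma SclassZ a (phi : kC_bimod k X E) (w : W) : Sclass (a *: phi) w = a *: Sclass phi w.
Proof. by rewrite /Sclass tpureZ linearZ. Qed.

Lemma Sclass_ind (P : Sfun W X -> Prop) :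
  P 0 -> (forall a s t, P s -> P t -> P (a *: s + t)) ->
  (forall S w, P (Sclass (kbase S : kC_bimod k X E) w)) -> forall s, P s.
Proof.
move=> P0 PL PS; elim/lquotW => t; elim/tensor_ind: t => [phi w||s t hs ht].
- rewrite -/(Sclass phi w); elim/kfree_ind: phi => [|S|a phi psi h1 h2] //.
    by rewrite /Sclass tpure0l linear0.
  by rewrite SclassDl SclassZ; apply: PL.
- by rewrite linear0.
- by rewrite linearB -scaleN1r addrC; apply: PL.
Qed.

Lemma Sclass_bal (phi : kC k X E) (a : kCalg k E) (w : W) :
  Sclass (phi : kC_bimod k X E) (a *: w) = Sclass (kcomp phi a : kC_bimod k X E) w.
Proof. by rewrite /Sclass -tpure_bal. Qed.

(** The difference is presented as a sum of two pure tensors, the form in which [Jfun] tests its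
    elements. *)
Lemma Sclass_eq (phi psi : kC k X E) (w : W) :
  (forall rho : kC k E X, (kcomp rho phi : kCalg k E) *: w = (kcomp rho psi : kCalg k E) *: w) ->
  Sclass (phi : kC_bimod k X E) w = Sclass (psi : kC_bimod k X E) w.
Proof.
move=> h; apply/lprojP/asboolP; exists [:: (phi, w); (- psi : kC k X E, w)].
have nE : (- psi : kC_bimod k X E) \ox w = - ((psi : kC_bimod k X E) \ox w).
  by rewrite -scaleN1r tpureZ scaleN1r.
split=> [|rho]; first by rewrite !big_cons big_nil addr0 /= nE.
rewrite !big_cons big_nil addr0 /= h -scalerDl /kcomp -kbilDr subrr kbil0r.
exact: scale0r.
Qed.

End SFunctor.

Section FundamentalModuleTheory.
Variables (k : fieldType) (E : finType) (R : porel E).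
Implicit Types (Q : corr E E) (alpha beta : {perm E}).

Lemma PEf_scaleE Q alpha :
  (kbase Q : kCalg k E) *: (kbase alpha : PEf k R) = pf_act k R Q alpha.
Proof. exact: kbilE. Qed.

Lemma pf_act1E Q beta : pf_act k R Q 1%g beta = (pf_witness R Q 1%g beta)%:R.
Proof.
have [h|h] := boolP (pf_witness R Q 1%g beta); first by rewrite (pf_actT k h) mul1g ffunE eqxx.
rewrite /pf_act; case: pickP => [b hb|_]; last by rewrite ffunE.
by rewrite mul1g ffunE; case: eqP => // e; rewrite e hb in h.
Qed.

(** This shows that f_R generates the module. *)
Lemma pf_act_Delta alpha : pf_act k R (Delta alpha) 1%g = kbase alpha.
Proof.
rewrite (@pf_actT _ _ _ _ _ alpha) ?mul1g //; apply/pf_witnessP; split=> [e|z x].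
  by rewrite inE.
by rewrite inE /= invg1 !perm1 => /eqP/perm_inj ->; apply: po_refl.
Qed.

Lemma PEf_scale1E (c : k) (m : kfree k {perm E}) :
  (c *: (1 : kCalg k E) : kCalg k E) *: (m : PEf k R) = (c *: m : kfree k {perm E}).
Proof.
rewrite -[in RHS](scale1r (m : PEf k R)).
exact: kbilZl.
Qed.

End FundamentalModuleTheory.

(** * The map Theta, seen through the tests *)

Section ThetaTheory.
Variables (k : fieldType) (d : Order.disp_t) (T : finTBLatticeType d) (X : finType).
Implicit Types (phi : {ffun X -> T}) (Y : irr T -> {set X}).

Local Notation E := (irr T).
Local Notation R := (irr_le T).
Local Notation f0 := (kbase (1%g : {perm irr T}) : PEf k (po_op (irr_le T))).

(** A left inverse of [Gam]. The class of S tensored with f_{R^op} depends on S only through this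
    map. *)
Definition joinmap (S : corr X E) : {ffun X -> T} :=
  [ffun x => (\join_(e | (x, e) \in S) irr_val e)%O].

Lemma joinmap_le (S : corr X E) x t :
  (joinmap S x <= t)%O = [forall e, ((x, e) \in S) ==> (irr_val e <= t)%O].
Proof.
rewrite ffunE; apply/joinsP/forallP => [h e|h e he]; first by apply/implyP/h.
exact: (implyP (h e)).
Qed.

Lemma joinmap_Gam phi : joinmap (Gam phi) = phi.
Proof.
apply/ffunP => x; apply/le_anti/andP; split.
  by rewrite joinmap_le; apply/forallP => e; rewrite inE; apply/implyP.
apply: le_irr => e he; rewrite ffunE.
by apply: (@joins_sup _ _ _ _ _ (@irr_val _ T)); rewrite inE.
Qed.

(** An irreducible below a join need not be below one of the joined elements, so U Gamma_phi may
    differ from Gamma_(U phi); the joins still agree. *)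
Lemma joinmap_cact (U : corr X X) phi : joinmap (ccomp U (Gam phi)) = cact U phi.
Proof.
apply/ffunP => x; apply/le_anti/andP; split.
  rewrite joinmap_le; apply/forallP => e; apply/implyP => /ccompP[y hy].
  rewrite inE /= => he; rewrite ffunE; apply: le_trans he _.
  exact: joins_sup.
rewrite ffunE; apply/joinsP => y hy; apply: le_irr => e he.
rewrite ffunE; apply: (@joins_sup _ _ _ _ _ (@irr_val _ T)).
by apply/ccompP; exists y; rewrite // inE.
Qed.

Definition rows (Q : corr E X) (beta : {perm E}) (e : E) : {set X} :=
  [set x | (beta e, x) \in Q].

(** The upper inclusion, read in R^op, bounds the join map by e on the row of [beta e]. The diagonal
    inclusion makes it equal to e somewhere on that row, because an irreducible join is one of the
    joined elements. *)
Lemma pf_witness_hits (Q : corr E X) (S : corr X E) beta :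
  pf_witness (po_op R) (ccomp Q S) 1%g beta = hits (rows Q beta) (joinmap S).
Proof.
have R1 e f : po_op R (((1 : {perm E})^-1)%g e) (((1 : {perm E})^-1)%g f) =
    (irr_val f <= irr_val e)%O.
  by rewrite invg1 !perm1.
apply/pf_witnessP/forallP => [[h1 h2] e|h]; [apply/hitP; split=> [x|]|split=> [e|e f]].
- rewrite inE joinmap_le => hx; apply/forallP => f; apply/implyP => hf.
  by rewrite -R1; apply: h2; apply/ccompP; exists x.
- have /ccompP[x hx hx'] := h1 e; exists x; rewrite ?inE //.
  apply/le_anti/andP; split; last first.
    by rewrite ffunE; apply: (@joins_sup _ _ _ _ _ (@irr_val _ T)).
  rewrite joinmap_le; apply/forallP => f; apply/implyP => hf.
  by rewrite -R1; apply: h2; apply/ccompP; exists x.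
- have /hitP[_ [x]] := h e; rewrite inE ffunE => hx.
  move/(irr_join_ex (irrP e)) => [f hf /val_inj ef].
  by apply/ccompP; exists x; rewrite // -ef.
- move=> /ccompP[x hx hf]; rewrite R1; have /hitP[le _] := h e.
  have := le x; rewrite inE => /(_ hx); rewrite joinmap_le.
  by move=> /forallP/(_ f)/implyP; apply.
Qed.

Lemma corr_scale_f0 (rho : kC k E X) (y : kC k X E) :
  (kcomp rho y : kCalg k E) *: f0 =
  kbil (fun Q S => pf_act k (po_op R) (ccomp Q S) 1%g) rho y.
Proof.
rewrite -[LHS]/(kbil (pf_act k (po_op R)) (kcomp rho y) f0).
pose g := fun (rho : kC k E X) (y : kC k X E) =>
  kbil (pf_act k (po_op R)) (kcomp rho y) f0.
apply: (@kbil_ext2 _ _ _ _ g); rewrite {}/g.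
- by move=> z a u v; rewrite /kcomp !kbil_linl.
- by move=> z a u v; rewrite /kcomp kbil_linr kbil_linl.
- by move=> z; apply: kbil_linl.
- by move=> z; apply: kbil_linr.
- by move=> Q S; rewrite /kcomp !kbilE.
Qed.

Lemma corr_scale_f0E (Q : corr E X) (y : kC k X E) beta :
  ((kcomp (kbase Q) y : kCalg k E) *: f0 : kfree k {perm E}) beta =
  hits_sum (rows Q beta) (kext (fun S => kbase (joinmap S) : kmap k T X) y).
Proof.
rewrite corr_scale_f0 /kbil kextE /kext linear_sum sum_ffunE.
apply: eq_bigr => S _; rewrite linearZ /= ffunE pf_act1E pf_witness_hits.
by rewrite /hits_sum kextE.
Qed.

Lemma Sclass_joinmap (y z : kC k X E) :
  (forall Y, hits_sum Y (kext (fun S => kbase (joinmap S) : kmap k T X) y) =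
             hits_sum Y (kext (fun S => kbase (joinmap S) : kmap k T X) z)) ->
  Sclass (y : kC_bimod k X E) f0 = Sclass (z : kC_bimod k X E) f0.
Proof.
move=> h; apply: Sclass_eq => rho; elim/kfree_ind: rho => [|Q|a u v hu hv].
- by rewrite /kcomp !kbil0l.
- apply/ffunP => beta; rewrite !corr_scale_f0E; exact: h.
- by rewrite !corr_scale_f0 !kbil_linl -!corr_scale_f0 hu hv.
Qed.

Lemma ThetaE (x : kmap k T X) :
  Theta x = Sclass (kext (fun phi => kbase (Gam phi) : kC k X E) x : kC_bimod k X E) f0.
Proof.
rewrite /Theta /kext; elim: (index_enum _) => [|phi r ih].
  by rewrite !big_nil /Sclass -(scale0r (0 : kC_bimod k X E)) tpureZ scale0r linear0.
by rewrite !big_cons ih SclassDl SclassZ.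
Qed.

Lemma kext_joinmap_Gam (x : kmap k T X) :
  kext (fun S => kbase (joinmap S) : kmap k T X)
    (kext (fun phi => kbase (Gam phi) : kC k X E) x) = x.
Proof.
rewrite [in RHS](kfree_sum x) {2}/kext linear_sum; apply: eq_bigr => phi _.
by rewrite linearZ /= kextE joinmap_Gam.
Qed.

Lemma Theta_eq (x y : kmap k T X) :
  (forall Y, hits_sum Y x = hits_sum Y y) -> Theta x = Theta y.
Proof.
move=> h; rewrite !ThetaE; apply: Sclass_joinmap => Y.
by rewrite !kext_joinmap_Gam.
Qed.

Lemma Sclass_Theta (S : corr X E) :
  Sclass (kbase S : kC_bimod k X E) f0 = Theta (kbase (joinmap S) : kmap k T X).
Proof.
rewrite ThetaE; apply: Sclass_joinmap => Y.
by rewrite kext_joinmap_Gam kextE.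
Qed.

Lemma Theta_pi_u (s : seq T) phi : perm_eq s (enum (lat_Gc T)) ->
  Theta (lat_pi (kmap_comp (u_comp k s) (kbase phi))) = Theta (kbase phi : kmap k T X).
Proof.
move=> hs; apply: Theta_eq => Y; rewrite hits_pi hits_u_comp // => a.
by rewrite (perm_mem hs) mem_enum.
Qed.

End ThetaTheory.

(** * The free action of Aut(E, R) on B *)

Section AutAction.
Variables (d : Order.disp_t) (T : finTBLatticeType d) (X : finType).
Hypothesis hT : bijective (@aut_restr d T).
Implicit Types (phi psi : Bmap T X) (s t : aut (irr_le T)).

Lemma aut_extE s (e : irr T) : aut_ext s (irr_val e) = irr_val (s e).
Proof. by rewrite -aut_restrE aut_extK. Qed.

Lemma Bmap_actE phi s x :
  Bmap_val (Bmap_act phi s) x = ((aut_ext s : {perm T})^-1)%g (Bmap_val phi x).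
Proof. exact: ffunE. Qed.

Lemma Bmap_act_inj s : injective (Bmap_act (X := X) ^~ s : Bmap T X -> Bmap T X).
Proof.
move=> phi psi h; apply/val_inj/ffunP => x.
by apply: (@perm_inj _ ((aut_ext s : {perm T})^-1)%g); rewrite -!Bmap_actE h.
Qed.

(** An automorphism fixing phi fixes all its values, and every irreducible is one. *)
Lemma Bmap_act_free phi s : Bmap_act phi s = phi -> s = 1%g.
Proof.
move=> h; apply/val_inj/permP => e; apply: val_inj => /=; rewrite perm1.
have := BmapP phi; case/andP => /forallP/(_ e)/codomP[x hx] _.
have := Bmap_actE phi s x; rewrite h -hx => hs.
by rewrite -aut_extE {1}hs permKV.
Qed.

(** Left translation is injective on a finite set; with t = 1 this yields inverses in the monoid
    [aut]. *)
Lemma aut_mul_surj s t : exists u, (s * u)%g = t.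
Proof.
have inj : injective (fun u : aut (irr_le T) => (s * u)%g).
  move=> u v h; apply/val_inj/permP => e; apply: (@perm_inj _ (aut_perm s)).
  by rewrite -!autME h.
by have [g _ gK] := injF_bij inj; exists (g t).
Qed.

(** The choice depends only on the predicate, hence only on the orbit; the default never occurs
    because phi lies in its own orbit. *)
Definition orbit_rep phi : Bmap T X :=
  odflt phi [pick psi | [exists s, Bmap_act phi s == psi]].

Lemma orbit_rep_act phi s : orbit_rep (Bmap_act phi s) = orbit_rep phi.
Proof.
rewrite /orbit_rep (eq_pick (Q := fun psi => [exists s, Bmap_act phi s == psi])).
  by case: pickP => // /(_ phi)/existsPn/(_ 1%g); rewrite Bmap_act1 ?eqxx.
move=> psi; apply/existsP/existsP => -[t /eqP <-].
  by exists (s * t)%g; rewrite Bmap_actM.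
by have [u <-] := aut_mul_surj s t; exists u; rewrite Bmap_actM.
Qed.

Lemma orbit_repP phi : exists s, Bmap_act (orbit_rep phi) s = phi.
Proof.
have [s hs] : exists s, Bmap_act phi s = orbit_rep phi.
  rewrite /orbit_rep; case: pickP => [psi /existsP[s /eqP]|_]; first by exists s.
  by exists 1%g; rewrite Bmap_act1.
have [u hu] := aut_mul_surj s 1%g; exists u.
by rewrite -hs -Bmap_actM // hu Bmap_act1.
Qed.

Lemma orbit_rep_id phi : orbit_rep (orbit_rep phi) = orbit_rep phi.
Proof. by have [s {2}<-] := orbit_repP phi; rewrite orbit_rep_act. Qed.

(** The extension of s preserves the order of T, so the condition at e on the left is the condition
    at s e on the right. *)
Lemma hits_act (Q : corr (irr T) X) phi s :
  hits (rows Q (aut_perm s)) (Bmap_val (Bmap_act phi s)) =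
  hits (rows Q 1%g) (Bmap_val phi).
Proof.
have hitE e : hit e (rows Q (aut_perm s) e) (Bmap_val (Bmap_act phi s)) =
    hit (s e) (rows Q 1%g (s e)) (Bmap_val phi).
  have rE : rows Q (aut_perm s) e = rows Q 1%g (s e).
    by apply/setP => x; rewrite !inE perm1.
  rewrite /hit rE; congr (_ && _); apply: eq_forallb => x || apply: eq_existsb => x.
    by rewrite Bmap_actE -aut_extE -[in RHS](permKV (aut_ext s) (Bmap_val phi x)) aut_le.
  rewrite Bmap_actE -aut_extE -[in RHS](permKV (aut_ext s) (Bmap_val phi x)).
  by rewrite (inj_eq perm_inj).
apply/forallP/forallP => h e; last by rewrite hitE.
by rewrite -[e](permKV (aut_perm s)) -hitE.
Qed.

End AutAction.

Section TensorKB.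
Variables (k : fieldType) (d : Order.disp_t) (T : finTBLatticeType d) (X : finType).
Variable V : lmodType (kAut k (irr_le T)).
Hypothesis hT : bijective (@aut_restr d T).
Implicit Types (phi psi : Bmap T X) (s t : aut (irr_le T)).

Local Notation kBX := (kB_bimod k hT X).
Local Notation M := (tensor kBX V).

(** Since V is given as a kAut-module, the scalar c acts on it as c times the identity
    automorphism. *)
Lemma kB_pureZ (c : k) phi (v : V) :
  c *: ((kbase phi : kBX) \ox v) =
  (kbase phi : kBX) \ox ((c *: (kbase 1%g : kfree k (aut (irr_le T))) : kAut k (irr_le T)) *: v).
Proof.
rewrite -tpureZ -tpure_bal; congr (_ \ox _).
by rewrite /= /kB_ract kbilZr kbilE Bmap_act1.
Qed.

Lemma kB_pure_act phi s (v : V) :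
  (kbase (Bmap_act phi s) : kBX) \ox v =
  (kbase phi : kBX) \ox ((kbase s : kAut k (irr_le T)) *: v).
Proof. by rewrite -tpure_bal /= /kB_ract kbilE. Qed.

Definition normal_form (v : Bmap T X -> V) : Prop :=
  forall phi, orbit_rep phi != phi -> v phi = 0.

(** A basis map is its orbit representative moved by some s, and s passes across the tensor to V. *)
Lemma tensor_normal_form (m : M) : exists2 v, normal_form v &
  m = \sum_phi (kbase phi : kBX) \ox v phi.
Proof.
pose P m := exists2 v, normal_form v & m = \sum_phi (kbase phi : kBX) \ox v phi.
have P0 : P 0.
  by exists (fun=> 0) => //; rewrite big1 // => phi _; apply: tpure0r.
have PD m1 m2 : P m1 -> P m2 -> P (m1 + m2).
  move=> [v hv ->] [w hw ->]; exists (fun phi => v phi + w phi) => [phi h|].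
    by rewrite hv ?hw ?addr0.
  by rewrite -big_split; apply: eq_bigr => phi _; rewrite tpureDr.
have PZ (c : k) m1 : P m1 -> P (c *: m1).
  move=> [v hv ->].
  exists (fun phi => (c *: (kbase 1%g : kfree k (aut (irr_le T))) :
    kAut k (irr_le T)) *: v phi) => [phi h|].
    by rewrite hv ?scaler0.
  by rewrite scaler_sumr; apply: eq_bigr => phi _; rewrite kB_pureZ.
elim/tensor_ind: m => [y v||m1 m2 h1 h2] //; last first.
  by apply: PD => //; rewrite -scaleN1r; apply: PZ.
elim/kfree_ind: y => [|phi|a x y hx hy]; first by rewrite tpure0l.
  have [s hs] := orbit_repP hT phi; rewrite -[in kbase phi]hs kB_pure_act.
  set w := _ *: v; exists (fun psi => if psi == orbit_rep phi then w else 0).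
    by move=> psi; case: (psi =P orbit_rep phi) => // ->; rewrite orbit_rep_id ?eqxx.
  rewrite (bigD1 (orbit_rep phi)) //= eqxx big1 ?addr0 // => psi /negbTE ->.
  exact: tpure0r.
by rewrite tpureDl tpureZ; apply: PD => //; apply: PZ.
Qed.

End TensorKB.

(** * The map from kB tensor V to S_{E,R^op,V}(X) *)

Section TensorIso.
Variables (k : fieldType) (d : Order.disp_t) (T : finTBLatticeType d) (X : finType).
Variable V : lmodType (kAut k (irr_le T)).
Hypothesis hT : bijective (@aut_restr d T).

Local Notation E := (irr T).
Local Notation R := (irr_le T).
Local Notation PE := (PEf_bimod k R).
Local Notation f0 := (kbase (1%g : {perm irr T}) : PEf k (po_op (irr_le T))).
Local Notation kBX := (kB_bimod k hT X).
Local Notation M := (tensor kBX V).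

Lemma Theta_linear : linear (@Theta k d T X).
Proof. exact: kext_is_linear. Qed.

Lemma kB_incl_linear : linear (@kB_incl k d T X).
Proof. exact: kext_is_linear. Qed.

Lemma kB_inclZ a (y : kB k T X) : kB_incl (a *: y) = a *: kB_incl y.
Proof. by rewrite /kB_incl linearZ. Qed.

Lemma Sract_Sclass (phi : kC_bimod k X E) (m : PE) (b : kAut k R) :
  Sract (Sclass phi m) b = Sclass phi (ract m b).
Proof. by rewrite /Sclass SractE tensor_ractE. Qed.

(** A scalar crosses the tensor over kC(E,E) as a multiple of the identity relation. *)
Lemma Sclass_scale_right (phi : kC_bimod k X E) (c : k) (m : kfree k {perm E}) :
  Sclass phi ((c *: m : kfree k {perm E}) : PE) = c *: Sclass phi (m : PE).
Proof.
rewrite -(PEf_scale1E (po_op R)) (Sclass_bal phi) -SclassZ.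
by congr (Sclass _ _); rewrite /kcomp kbilZr -/(kcomp _ _) kcomp1.
Qed.

Lemma Sclass_tpure_scale (phi : kC_bimod k X E) (c : k) (m : kfree k {perm E}) (v : V) :
  Sclass phi (((c *: m : kfree k {perm E}) : PE) \ox v) = c *: Sclass phi ((m : PE) \ox v).
Proof.
rewrite -(PEf_scale1E (po_op R)) (tpureZ (_ : kCalg k E) (m : PE)) (Sclass_bal phi).
by rewrite -SclassZ; congr (Sclass _ _); rewrite /kcomp kbilZr -/(kcomp _ _) kcomp1.
Qed.

(** Each basis vector of P_E f_{R^op} is [Delta alpha] applied to f_{R^op}, and [Delta alpha] moves
    across the tensor into the correspondence. *)
Lemma SEopV_ind (P : SEopV V X -> Prop) :
  P 0 -> (forall a s t, P s -> P t -> P (a *: s + t)) ->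
  (forall S v, P (Sclass (kbase S : kC_bimod k X E) ((f0 : PE) \ox v))) ->
  forall s, P s.
Proof.
move=> P0 PL PS; apply: Sclass_ind => // S w.
elim/tensor_ind: w => [m v||w1 w2 h1 h2].
- elim/kfree_ind: m => [|alpha|a m1 m2 h1 h2].
  + by rewrite tpure0l -[0](scale0r 0) Sclass_bal /kcomp kbil0r /Sclass tpure0l linear0.
  + rewrite -(pf_act_Delta k (po_op R) alpha) -PEf_scaleE.
    by rewrite (tpureZ (_ : kCalg k E) (f0 : PE)) Sclass_bal /kcomp kbilE.
  + by rewrite tpureDl SclassDr Sclass_tpure_scale; apply: PL.
- by rewrite -[0](scale0r 0) Sclass_bal /kcomp kbil0r /Sclass tpure0l linear0.
- have -> : w1 - w2 = (-1) *: w2 + w1 by rewrite scaleN1r addrC.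
  rewrite SclassDr; have -> : Sclass (kbase S : kC_bimod k X E) ((-1) *: w2) =
      (-1) *: Sclass (kbase S : kC_bimod k X E) w2; last exact: PL.
  rewrite Sclass_bal -SclassZ; congr (Sclass _ _).
  by rewrite scaleN1r /kcomp -[- 1]scaleN1r kbilZr -/(kcomp _ _) kcomp1 scaleN1r.
Qed.

(** The action of s turns f_{R^op} into Delta_s f_{R^op}, hence Gamma_phi into Gamma_phi Delta_s,
    whose join map is the inverse of s composed with phi. *)
Lemma Theta_Bmap_act phi s :
  Theta (kbase (Bmap_val (Bmap_act phi s)) : kmap k T X) =
  Sract (Theta (kbase (Bmap_val phi) : kmap k T X)) (kbase s).
Proof.
rewrite /Theta !kextE Sract_Sclass /= /PEf_ract kbilE mulg1.
rewrite -(pf_act_Delta k (po_op R) (aut_perm s)) -PEf_scaleE Sclass_bal /kcomp kbilE.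
rewrite !Sclass_Theta; congr (Theta (kbase _)).
rewrite joinmap_Gam; apply/ffunP => x; apply/le_anti/andP; split.
  apply: le_irr => e; rewrite Bmap_actE -aut_leV ?aut_extE // => he.
  rewrite ffunE; apply: (@joins_sup _ _ _ _ _ (@irr_val _ T)).
  apply/ccompP; exists (s e); rewrite inE //=.
rewrite joinmap_le; apply/forallP => e; apply/implyP => /ccompP[f].
by rewrite !inE /= => he /eqP ef; rewrite Bmap_actE -aut_leV aut_extE // -ef.
Qed.

Lemma Theta_ract (y : kBX) (a : kAut k R) :
  Theta (kB_incl (ract y a)) = Sract (Theta (kB_incl y)) a.
Proof.
pose g (y : kfree k (Bmap T X)) (a : kfree k (aut R)) : SEop k R X :=
  Theta (kB_incl (kB_ract y a)).
pose g' (y : kfree k (Bmap T X)) (a : kfree k (aut R)) : SEop k R X :=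
  Sract (Theta (kB_incl y)) a.
apply: (@kbil_ext2 _ _ _ _ g g'); rewrite {}/g {}/g'.
- by move=> z c u v; rewrite [kB_ract _ _]kbil_linl kB_incl_linear Theta_linear.
- by move=> z c u v; rewrite [kB_ract _ _]kbil_linr kB_incl_linear Theta_linear.
- by move=> z c u v; rewrite kB_incl_linear Theta_linear SractDl SractZ.
- move=> z c u v; rewrite SractDr; congr (_ + _); rewrite ThetaE !Sract_Sclass.
  by rewrite -Sclass_scale_right; congr (Sclass _ _); apply: kbilZr.
- move=> phi s; rewrite /kB_ract kbilE /kB_incl !kextE; exact: Theta_Bmap_act.
Qed.

Definition kB_to_S : M -> SEopV V X :=
  tlift (fun (y : kBX) (v : V) => Psi ((Theta (kB_incl y) : SEop k R X) \ox v)).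

Lemma kB_to_S_bal :
  balanced (fun (y : kBX) (v : V) => Psi ((Theta (kB_incl y) : SEop k R X) \ox v)).
Proof.
split=> [y z v|y v w|y a v].
- have -> : Theta (kB_incl (y + z)) = Theta (kB_incl y) + Theta (kB_incl z).
    have := kB_incl_linear 1 y z; rewrite !scale1r => ->.
    by have := Theta_linear 1 (kB_incl y) (kB_incl z); rewrite !scale1r.
  by rewrite tpureDl; apply: (tliftD (Psi_outer_bal _ _ _)).
- by rewrite tpureDr; apply: (tliftD (Psi_outer_bal _ _ _)).
- by rewrite Theta_ract -(tpure_bal (M := SEop k R X)).
Qed.

Lemma kB_to_SE (y : kBX) (v : V) :
  kB_to_S (y \ox v) = Psi ((Theta (kB_incl y) : SEop k R X) \ox v).
Proof. exact: (tliftE kB_to_S_bal). Qed.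

Lemma Psi_Theta (x : kmap k T X) (v : V) :
  Psi ((Theta x : SEop k R X) \ox v) =
  Sclass (kext (fun phi => kbase (Gam phi) : kC k X E) x : kC_bimod k X E)
    ((f0 : PE) \ox v).
Proof. by rewrite ThetaE PsiE. Qed.

Lemma kB_to_S_Sclass (y : kBX) (v : V) :
  kB_to_S (y \ox v) =
  Sclass (kext (fun phi => kbase (Gam phi) : kC k X E) (kB_incl y) : kC_bimod k X E)
    ((f0 : PE) \ox v).
Proof. by rewrite kB_to_SE; apply: Psi_Theta. Qed.

Lemma kB_to_SB s t : kB_to_S (s - t) = kB_to_S s - kB_to_S t.
Proof. exact: (tliftB kB_to_S_bal). Qed.

Lemma kB_to_S0 : kB_to_S 0 = 0.
Proof. exact: (tlift0 kB_to_S_bal). Qed.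

Lemma kB_to_SD s t : kB_to_S (s + t) = kB_to_S s + kB_to_S t.
Proof. exact: (tliftD kB_to_S_bal). Qed.

Lemma kB_to_SZ a t : kB_to_S (a *: t) = a *: kB_to_S t.
Proof.
elim/tensor_ind: t => [y v||u w hu hw]; last 2 first.
- by rewrite scaler0 kB_to_S0 scaler0.
- by rewrite scalerBr !kB_to_SB hu hw scalerBr.
rewrite -tpureZ !kB_to_S_Sclass -SclassZ; congr (Sclass _ _).
by rewrite (kB_inclZ a y : kB_incl (a *: y) = _) linearZ.
Qed.

Lemma kB_to_S_linear : linear kB_to_S.
Proof. by move=> a s t; rewrite kB_to_SD kB_to_SZ. Qed.

HB.instance Definition _ := GRing.isLinear.Build k M (SEopV V X) *:%R kB_to_S kB_to_S_linear.

End TensorIso.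

(** * Surjectivity, and injectivity through forms with values in V *)

Section TensorIsoBijective.
Variables (k : fieldType) (d : Order.disp_t) (T : finTBLatticeType d) (X : finType).
Variable V : lmodType (kAut k (irr_le T)).
Hypothesis hT : bijective (@aut_restr d T).

Local Notation E := (irr T).
Local Notation R := (irr_le T).
Local Notation PE := (PEf_bimod k R).
Local Notation f0 := (kbase (1%g : {perm irr T}) : PEf k (po_op (irr_le T))).
Local Notation kBX := (kB_bimod k hT X).
Local Notation M := (tensor kBX V).
Local Notation F := (@kB_to_S k d T X V hT).

Lemma kB_to_S_cact (s : seq T) (U : corr X X) (phi : Bmap T X) (v : V) (y : kBX) :
  perm_eq s (enum (lat_Gc T)) ->
  kB_incl y = lat_pi (kmap_comp (u_comp k s) (kbase (cact U (Bmap_val phi)))) ->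
  Sact (kbase U) (F ((kbase phi : kBX) \ox v)) = F (y \ox v).
Proof.
move=> hs hy; rewrite kB_to_S_Sclass /kB_incl !kextE SactE /kcomp kbilE.
by rewrite kB_to_SE hy Theta_pi_u // -joinmap_cact -Sclass_Theta PsiE.
Qed.

Lemma kB_to_S_surj (w : SEopV V X) : exists t, F t = w.
Proof.
elim/SEopV_ind: w => [|a w1 w2 [t1 <-] [t2 <-]|S v].
- by exists 0; rewrite kB_to_S0.
- by exists (a *: t1 + t2); rewrite kB_to_S_linear.
have [y hy] := pi_u_comp_in_kB k (joinmap S) (perm_refl (enum (lat_Gc T))).
by exists ((y : kBX) \ox v); rewrite kB_to_SE hy Theta_pi_u // -PsiE Sclass_Theta.
Qed.

(* P_E f_{R^op} is free over kAut(E, R), with f_{R^op} in a basis; this is the *)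
(* coordinate on f_{R^op}.                                                    *)
Definition aut_part (m : kfree k {perm E}) : kfree k (aut R) := [ffun s => m (aut_perm s)].

Lemma aut_part_linear : linear aut_part.
Proof. by move=> a m n; apply/ffunP => s; rewrite !ffunE. Qed.

Lemma aut_part_ract (m : PE) (a : kAut k R) :
  aut_part (ract m a) = (aut_part m : kAut k R) * a.
Proof.
pose g (m : kfree k {perm E}) (a : kfree k (aut R)) := aut_part (PEf_ract (m : PEf k (po_op R)) a).
pose g' (m : kfree k {perm E}) (a : kfree k (aut R)) : kfree k (aut R) :=
  kmon_mul (aut_part m : kmon k (aut R)) a.
apply: (@kbil_ext2 _ _ _ _ g g'); rewrite {}/g {}/g'.
- by move=> z c u v; rewrite [PEf_ract _ _]kbil_linl aut_part_linear.
- by move=> z c u v; rewrite [PEf_ract _ _]kbil_linr aut_part_linear.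
- by move=> z c u v; rewrite aut_part_linear [LHS]kbil_linl.
- by move=> z c u v; rewrite [LHS]kbil_linr.
move=> alpha s; rewrite /PEf_ract kbilE.
have [[t ->]|nt] := pselect (exists t : aut R, alpha = aut_perm t).
  have pE (u : aut R) : aut_part (kbase (aut_perm u)) = kbase u.
    by apply/ffunP => v; rewrite !ffunE (inj_eq val_inj).
  by rewrite pE /kmon_mul kbilE -pE.
have -> : aut_part (kbase alpha) = 0.
  by apply/ffunP => t; rewrite !ffunE; case: eqP => // e; case: nt; exists t.
rewrite [RHS]kbil0l; apply/ffunP => t; rewrite !ffunE; case: eqP => // e; case: nt.
(* If alpha composed with s is an automorphism, so is alpha: compose with the inverse of s. *)
have [u hu] := aut_mul_surj s 1%g; exists (t * u)%g.
have su : (aut_perm u * aut_perm s)%g = 1%g by have := congr1 (@aut_perm _ _) hu.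
by rewrite /= e mulgA su mul1g.
Qed.

Definition aut_coef : tensor PE V -> V :=
  tlift (fun (m : PE) (v : V) => (aut_part m : kAut k R) *: v).

Lemma aut_coef_bal : balanced (fun (m : PE) (v : V) => (aut_part m : kAut k R) *: v).
Proof.
split=> [m n v|m v w|m a v].
- rewrite -scalerDl; congr (_ *: _); have := aut_part_linear 1 m n.
  by rewrite !scale1r.
- by rewrite scalerDr.
- by rewrite aut_part_ract scalerA.
Qed.

Definition hits_coef (Q : corr E X) (w : SEopV V X) : V := aut_coef (Sev (kbase Q) w).

Lemma hits_coefB Q w1 w2 : hits_coef Q (w1 - w2) = hits_coef Q w1 - hits_coef Q w2.
Proof. by rewrite /hits_coef SevB; apply: (tliftB aut_coef_bal). Qed.

Lemma hits_coef0 Q : hits_coef Q 0 = 0.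
Proof. by rewrite -[X in hits_coef Q X](subrr 0) hits_coefB subrr. Qed.

Lemma hits_coefD Q w1 w2 : hits_coef Q (w1 + w2) = hits_coef Q w1 + hits_coef Q w2.
Proof. by rewrite -{1}[w2]opprK -[- w2]sub0r !hits_coefB hits_coef0 sub0r opprK. Qed.

Lemma hits_coefE Q (phi : Bmap T X) (v : V) :
  hits_coef Q (F ((kbase phi : kBX) \ox v)) =
  \sum_s ((kbase s : kAut k R) *: v) *+ hits (rows Q (aut_perm s)) (Bmap_val phi).
Proof.
rewrite kB_to_S_Sclass /kB_incl !kextE /hits_coef SevE /kcomp kbilE -tpureZ.
rewrite [LHS](tliftE aut_coef_bal) PEf_scaleE.
have -> : aut_part (pf_act k (po_op R) (ccomp Q (Gam (Bmap_val phi))) 1%g) =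
    \sum_s (kbase s : kAut k R) *+ hits (rows Q (aut_perm s)) (Bmap_val phi) :> kAut k R.
  rewrite [LHS]kfree_sum /kext; apply: eq_bigr => s _.
  rewrite ffunE pf_act1E pf_witness_hits joinmap_Gam.
  by case: (hits _ _); rewrite ?scale1r ?scale0r.
by rewrite scaler_suml; apply: eq_bigr => s _; rewrite scalerMnl.
Qed.

Lemma kB_to_S_ker t : F t = 0 -> t = 0.
Proof.
have [v hv ->] := tensor_normal_form t => Ft.
(* This is the coefficient of phi after reindexing each sum over B by the action of s; [hits_act]
   then makes all tests the same. *)
pose lam (phi : Bmap T X) : V := \sum_s (kbase s : kAut k R) *: v (Bmap_act phi s).
pose lam' (psi : {ffun X -> T}) : V := if insub psi is Some phi then lam phi else 0.
have lam'E phi : lam' (Bmap_val phi) = lam phi by rewrite /lam' valK.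
have sum0 Q : \sum_phi lam phi *+ hits (rows Q 1%g) (Bmap_val phi) = 0.
  rewrite -[RHS](hits_coef0 Q) -[in RHS]Ft.
  have -> : hits_coef Q (F (\sum_phi (kbase phi : kBX) \ox v phi)) =
      \sum_phi hits_coef Q (F ((kbase phi : kBX) \ox v phi)).
    elim: (index_enum _) => [|phi r ih]; first by rewrite !big_nil kB_to_S0 hits_coef0.
    by rewrite !big_cons kB_to_SD hits_coefD ih.
  under [RHS]eq_bigr => phi _ do rewrite hits_coefE.
  rewrite [RHS]exchange_big /=.
  under [RHS]eq_bigr => s _ do rewrite (reindex_inj (@Bmap_act_inj d T X s)) /=.
  rewrite [RHS]exchange_big /=; apply: eq_bigr => phi _.
  by rewrite -sumrMnl; apply: eq_bigr => s _; rewrite hits_act.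
have lam0 phi : lam phi = 0.
  rewrite -lam'E; apply: hits_independent => [psi|Y].
    by rewrite /lam'; case: insubP => [b hb _ _|]; rewrite ?eqxx.
  (* Any family [Y] is the family of rows of a correspondence. *)
  pose Q : corr E X := [set p : E * X | p.2 \in Y p.1].
  have YQ e : Y e = rows Q 1%g e by apply/setP => x; rewrite !inE perm1.
  have hQ psi : hits Y psi = hits (rows Q 1%g) psi.
    by apply: eq_forallb => e; rewrite YQ.
  rewrite -[RHS](sum0 Q).
  rewrite (bigID (fun psi => (covers_irr psi && [forall x, psi x \in lat_G T]))) /=.
  rewrite [X in _ + X]big1 ?addr0 => [|psi hpsi]; last first.
    by rewrite /lam' insubF ?mul0rn //; apply/negbTE.
  rewrite (reindex_omap (@Bmap_val d T X) insub) => [|psi hpsi] /=; last first.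
    by rewrite insubT.
  apply: eq_big => [phi'|phi' _]; first by rewrite BmapP valK eqxx.
  by rewrite lam'E hQ.
apply: big1 => phi _; have [rp|] := eqVneq (orbit_rep phi) phi; last first.
  by move=> h; rewrite hv // tpure0r.
suff -> : v phi = 0 by apply: tpure0r.
(* By freeness phi is the only representative in its orbit, reached only by s = 1, so [lam phi]
   reduces to [v phi]. *)
rewrite -[RHS](lam0 phi) /lam (bigD1 1%g) //= Bmap_act1 //.
rewrite big1 ?addr0 => [|s ns]; first by rewrite -[LHS]scale1r.
rewrite hv ?scaler0 // orbit_rep_act // rp; apply: contra ns => /eqP h.
by apply/eqP/(@Bmap_act_free _ _ X hT phi).
Qed.

End TensorIsoBijective.

Theorem theorem7p3 (k : fieldType) (X : finType)
    (d : Order.disp_t) (T : finTBLatticeType d)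
    (V : lmodType (kAut k (irr_le T))) (hV : simple_lmodule V)
    (hT : bijective (@aut_restr d T)) :
  exists (F : {linear tensor (kB_bimod k hT X) V -> SEopV V X})
         (F' : {linear SEopV V X -> tensor (kB_bimod k hT X) V}),
    (* (a) *)
    [/\ cancel F F', cancel F' F,
        forall (phi : Bmap T X) (v : V),
          F ((kbase phi : kB_bimod k hT X) \ox v) =
          Psi (Theta (kbase (Bmap_val phi)) \ox v)
    (* (b) *)
      & forall s : seq T, perm_eq s (enum (lat_Gc T)) ->
        forall (U : corr X X) (phi : Bmap T X) (v : V),
          exists2 y : kB_bimod k hT X,
            kB_incl y = lat_pi (kmap_comp (u_comp k s) (kbase (cact U (Bmap_val phi)))) &
            F' (Sact (kbase U) (F ((kbase phi : kB_bimod k hT X) \ox v))) = y \ox v].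
Proof.
have inj : injective (@kB_to_S k d T X V hT).
  move=> t1 t2 h; apply/eqP; rewrite -subr_eq0; apply/eqP/kB_to_S_ker.
  by rewrite kB_to_SB h subrr.
have [G [FK GK]] := linear_bij_inverse inj (@kB_to_S_surj k d T X V hT).
exists (@kB_to_S k d T X V hT), G; split=> // [phi v|s hs U phi v].
  have := kB_to_SE (kbase phi : kB_bimod k hT X) v.
  by rewrite /kB_incl kextE.
have [y hy] := pi_u_comp_in_kB k (cact U (Bmap_val phi)) hs.
by exists y => //; rewrite -[RHS]FK; congr (G _); exact: kB_to_S_cact hs hy.
Qed.
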